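(* Let $\alpha>1$ and set $$\varrho_0(n)=\frac{d_\alpha(n)}{\sqrt n\,(\log n)^\alpha},\qquad n\ge2.$$ The corresponding weighted multiplicative Hankel form on $\ell^2_{d_\alpha}(\mathbb N_{\ge2})$ in each variable, $$\mathcal H_{\varrho_0,d_\alpha}(a,b)=\sum_{m,n\ge2}\frac{a_mb_n}{\sqrt{mn}\,(\log(mn))^\alpha},$$ is bounded and not compact. More generally, let $\varrho=(\varrho_n)_{n\ge1}$ be a complex sequence and let $\mathcal H_{\varrho,d_\alpha}$ be the corresponding weighted multiplicative Hankel form on $\ell^2_{d_\alpha}(\mathbb N)$. Then: (1) If $\varrho_n=O(\varrho_0(n))$ as $n\to\infty$, then $\mathcal H_{\varrho,d_\alpha}$ is bounded. (2) If $\varrho_n=o(\varrho_0(n))$ as $n\to\infty$, then $\mathcal H_{\varrho,d_\alpha}$ is compact. (3) If $\varrho_n/\varrho_0(n)\to+\infty$ as $n\to\infty$, then $\mathcal H_{\varrho,d_\alpha}$ is unbounded.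
   Context: For $\alpha>1$ the coefficients $d_\alpha(n)>0$ are defined by $\zeta(s)^\alpha=\sum_{n\ge1}d_\alpha(n)n^{-s}$, $\operatorname{Re}s>1$. $\mathbb N_{\ge2}=\{2,3,\dots\}$. The space $\ell^2_{d_\alpha}(\mathbb N)$ (resp. $\ell^2_{d_\alpha}(\mathbb N_{\ge2})$) consists of complex sequences indexed by $n\ge1$ (resp. $n\ge2$) with $\|a\|_{\ell^2_{d_\alpha}}^2:=\sum_n|a_n|^2/d_\alpha(n)<\infty$. For a complex sequence $\varrho=(\varrho_n)_{n\ge1}$, the weighted multiplicative Hankel form is defined on finitely supported sequences by $$\mathcal H_{\varrho,d_\alpha}(a,b)=\sum_{m,n\ge1}a_mb_n\frac{\varrho_{mn}}{d_\alpha(mn)}.$$ The form is bounded if $|\mathcal H_{\varrho,d_\alpha}(a,b)|\le C\|a\|_{\ell^2_{d_\alpha}}\|b\|_{\ell^2_{d_\alpha}}$ for some $C$ and all finitely supported $a,b$. Boundedness and compactness of the form mean boundedness and compactness on $\ell^2(\mathbb N)$ of the operator with matrix $\left(\frac{\sqrt{d_\alpha(m)d_\alpha(n)}}{d_\alpha(mn)}\varrho_{mn}\right)_{m,n\ge1}$ (with indices restricted to $m,n\ge2$ and $\ell^2(\mathbb N_{\ge2})$ in the case of the form on $\ell^2_{d_\alpha}(\mathbb N_{\ge2})$). *)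

(* Defs.v *)
From Stdlib Require Import Reals.
From Coquelicot Require Import Coquelicot.
Open Scope R_scope.

Definition Cexp (z : C) : C :=
  (exp (Re z) * cos (Im z), exp (Re z) * sin (Im z)).

(* n ^ s, for n >= 1 *)
Definition Cnpow (n : nat) (s : C) : C := Cexp (s * RtoC (ln (INR n)))%C.

(* Meaningful only for convergent series, like [Series]. *)
Definition CSeries (u : nat -> C) : C :=
  (Series (fun k => Re (u k)), Series (fun k => Im (u k))).

Definition zeta (s : C) : C := CSeries (fun k => Cnpow (S k) (- s)%C).

(* d is the coefficient sequence of the Dirichlet series of zeta^alpha on
   Re s > 1. Here zeta^alpha = exp (alpha * L), where L is the branch of
   log zeta on the half-plane that is real on the real axis; since zeta is
   continuous and non-vanishing there, this determines L.  The value [d 0]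
   plays no role. *)
Definition zeta_pow_coeffs (alpha : R) (d : nat -> R) : Prop :=
  exists L : C -> C,
    (forall s : C, 1 < Re s -> continuous L s) /\
    (forall s : C, 1 < Re s -> Cexp (L s) = zeta s) /\
    (forall x : R, 1 < x -> Im (L (RtoC x)) = 0) /\
    (forall s : C, 1 < Re s ->
       is_series (fun k => RtoC (d (S k)) * Cnpow (S k) (- s))%C
                 (Cexp (RtoC alpha * L s)%C)).

(* Sequences are functions on nat; a parameter N restricts the index set to
   {n | N <= n}, and values at indices below N are ignored.  N = 1 and N = 2
   give the two index sets of interest. *)

Definition l2w_norm (d : nat -> R) (N : nat) (a : nat -> C) : R :=
  sqrt (Series (fun k => Cmod (a (N + k)%nat) ^ 2 / d (N + k)%nat)).

Definition supported_upto (M : nat) (a : nat -> C) : Prop :=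
  forall n : nat, (M < n)%nat -> a n = RtoC 0.

(* For a, b supported up to M, the sum over all m, n >= N reduces to
   N <= m, n <= M. *)
Definition hankel_form (d : nat -> R) (rho : nat -> C) (N M : nat)
    (a b : nat -> C) : C :=
  sum_n_m (fun m =>
    sum_n_m (fun n =>
      a m * b n * (rho (m * n)%nat / RtoC (d (m * n)%nat)))%C N M) N M.

Definition hankel_bounded (d : nat -> R) (rho : nat -> C) (N : nat) : Prop :=
  exists K : R, forall (M : nat) (a b : nat -> C),
    supported_upto M a -> supported_upto M b ->
    Cmod (hankel_form d rho N M a b) <= K * l2w_norm d N a * l2w_norm d N b.

Definition in_l2 (N : nat) (a : nat -> C) : Prop :=
  ex_series (fun k => Cmod (a (N + k)%nat) ^ 2).

Definition l2_norm (N : nat) (a : nat -> C) : R :=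
  sqrt (Series (fun k => Cmod (a (N + k)%nat) ^ 2)).

Definition matrix_op (A : nat -> nat -> C) (N : nat) (a : nat -> C) : nat -> C :=
  fun m => CSeries (fun k => A m (N + k)%nat * a (N + k)%nat)%C.

Definition is_l2_operator (A : nat -> nat -> C) (N : nat) : Prop :=
  forall a : nat -> C, in_l2 N a ->
    (forall m : nat, (N <= m)%nat ->
       ex_series (fun k => A m (N + k)%nat * a (N + k)%nat)%C) /\
    in_l2 N (matrix_op A N a).

(* The operator maps bounded sequences to sequences having a norm convergent
   subsequence. *)
Definition compact_l2_operator (A : nat -> nat -> C) (N : nat) : Prop :=
  is_l2_operator A N /\
  forall (x : nat -> nat -> C) (K : R),
    (forall j : nat, in_l2 N (x j) /\ l2_norm N (x j) <= K) ->
    exists (phi : nat -> nat) (y : nat -> C),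
      (forall j : nat, (phi j < phi (S j))%nat) /\
      in_l2 N y /\
      is_lim_seq
        (fun j => l2_norm N (fun n => matrix_op A N (x (phi j)) n - y n)%C) 0.

Definition hankel_matrix (d : nat -> R) (rho : nat -> C) (m n : nat) : C :=
  (RtoC (sqrt (d m * d n) / d (m * n)%nat) * rho (m * n)%nat)%C.

Definition hankel_compact (d : nat -> R) (rho : nat -> C) (N : nat) : Prop :=
  compact_l2_operator (hankel_matrix d rho) N.

Definition rho0 (alpha : R) (d : nat -> R) (n : nat) : R :=
  d n / (sqrt (INR n) * Rpower (ln (INR n)) alpha).

Definition seq_bigO (u : nat -> C) (v : nat -> R) : Prop :=
  exists K : R, eventually (fun n => Cmod (u n) <= K * Rabs (v n)).

Definition seq_littleo (u : nat -> C) (v : nat -> R) : Prop :=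
  forall eps : R, 0 < eps -> eventually (fun n => Cmod (u n) <= eps * Rabs (v n)).

(* Main.v *)
Require Import Defs.
From Stdlib Require Import Reals Lra Lia Classical ClassicalEpsilon FunctionalExtensionality.
From Coquelicot Require Import Coquelicot.
Open Scope R_scope.

(** Only two facts about [d] matter: [d n >= 1], and
    [sum_(n <= x) d n / n] is of the exact order [(ln x)^alpha].

    For positivity, the Dirichlet coefficients of [zeta^alpha] are read off
    from its asymptotic expansion along the real axis at infinity.  Sieving
    out small primes writes [zeta^b] as a finite product of Euler factors
    [(1 - p^(-x))^(-b)], whose coefficients are nonnegative, up to a negligible
    error; taking [b = alpha - 1] and multiplying by [zeta] gives [d n >= 1].
    The order of the partial sums follows from [1/s <= zeta (1+s) <= 1 + 1/s]
    by Rankin's trick.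

    With [e n = d n / n] and [p n = (ln n)^(-alpha/2)], the matrix of the form
    is dominated by [sqrt (e m * e n) * min (p m) (p n)^2], which passes the
    Schur test with weight [sqrt (e n) * p n]; this gives boundedness, and
    compactness when the columns decay relative to this kernel.  Conversely,
    the sequences [d n / sqrt n] on segments [X, Y] show that the form of
    [rho0] is bounded below by a constant on sequences supported far out. *)


(** * Finite sums and series of real numbers *)

(** The hypothesis on [d] is an identity of functions that gives no formula for the coefficients, so
    their sign has to be read off through uniqueness of expansions. Working modulo (N+2)^(-x), for
    one N at a time, keeps the Euler product finite: sieving by 2, ..., N+1 leaves 1 +
    O((N+2)^(-x)), and real powers of such a function have the same form. The exponent alpha/2 in
    [p] balances the growth: the sum of [e j] over j <= n is of the order of [p n] to the power -2.
    The model kernel arises because ln (m n) lies between the larger of ln m, ln n and twice that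
    number. Replacing it by the maximum therefore loses at most a factor 2^alpha, which is why upper
    and lower bounds match and the decay in [rho0] is critical. For non-compactness, the normalized
    test sequences move off to infinity, hence tend weakly to 0, while the quadratic form stays
    bounded below on them. *)

Lemma sum_n_SR (u : nat -> R) (n : nat) : sum_n u (S n) = sum_n u n + u (S n) :> R.
Proof. exact (sum_Sn u n). Qed.

Lemma sum_n_OR (u : nat -> R) : sum_n u 0 = u 0%nat :> R.
Proof. exact (sum_O u). Qed.

Lemma sum_n_ext_locR (u v : nat -> R) (n : nat) :
  (forall k, (k <= n)%nat -> u k = v k) -> sum_n u n = sum_n v n :> R.
Proof. exact (sum_n_ext_loc u v n). Qed.

Lemma sum_n_extR (u v : nat -> R) (n : nat) :
  (forall k, u k = v k) -> sum_n u n = sum_n v n :> R.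
Proof. exact (sum_n_ext u v n). Qed.

Lemma sum_n_le_loc (u v : nat -> R) (n : nat) :
  (forall k, (k <= n)%nat -> u k <= v k) -> sum_n u n <= sum_n v n.
Proof.
  induction n as [|n IH]; intros H.
  - rewrite !sum_n_OR; apply H; lia.
  - rewrite !sum_n_SR; apply Rplus_le_compat; [apply IH; intros; apply H|apply H]; lia.
Qed.

Lemma sum_n_nonneg (u : nat -> R) (n : nat) :
  (forall k, (k <= n)%nat -> 0 <= u k) -> 0 <= sum_n u n.
Proof.
  induction n as [|n IH]; intros H.
  - rewrite sum_n_OR; apply H; lia.
  - rewrite sum_n_SR; apply Rplus_le_le_0_compat; [apply IH; intros; apply H|apply H]; lia.
Qed.

Lemma sum_n_mono (u : nat -> R) (n m : nat) :
  (forall k, 0 <= u k) -> (n <= m)%nat -> sum_n u n <= sum_n u m.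
Proof.
  intros H; induction 1 as [|m _ IH]; [lra|].
  rewrite sum_n_SR; specialize (H (S m)); lra.
Qed.

Lemma sum_n_scalR (c : R) (u : nat -> R) (n : nat) :
  sum_n (fun k => c * u k) n = c * sum_n u n :> R.
Proof. exact (sum_n_mult_l c u n). Qed.

Lemma sum_n_scalR_r (c : R) (u : nat -> R) (n : nat) :
  sum_n (fun k => u k * c) n = sum_n u n * c :> R.
Proof. exact (sum_n_mult_r c u n). Qed.

Lemma sum_n_plusR (u v : nat -> R) (n : nat) :
  sum_n (fun k => u k + v k) n = sum_n u n + sum_n v n :> R.
Proof. exact (sum_n_plus u v n). Qed.

Lemma sum_n_minusR (u v : nat -> R) (n : nat) :
  sum_n (fun k => u k - v k) n = sum_n u n - sum_n v n :> R.
Proof.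
  induction n as [|n IH].
  - rewrite !sum_n_OR; reflexivity.
  - rewrite !sum_n_SR, IH; ring.
Qed.

Lemma sum_n_Rabs (u : nat -> R) (n : nat) :
  Rabs (sum_n u n) <= sum_n (fun k => Rabs (u k)) n.
Proof.
  induction n as [|n IH].
  - rewrite !sum_n_OR; lra.
  - rewrite !sum_n_SR; eapply Rle_trans; [apply Rabs_triang|lra].
Qed.

Lemma sum_n_term_le (u : nat -> R) (n k : nat) :
  (forall i, (i <= n)%nat -> 0 <= u i) -> (k <= n)%nat -> u k <= sum_n u n.
Proof.
  induction n as [|n IH]; intros H Hk.
  - replace k with 0%nat by lia; rewrite sum_n_OR; lra.
  - rewrite sum_n_SR.
    destruct (Nat.eq_dec k (S n)) as [->|Hn].
    + assert (0 <= sum_n u n) by (apply sum_n_nonneg; intros; apply H; lia); lra.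
    + assert (u k <= sum_n u n) by (apply IH; [intros; apply H|]; lia).
      specialize (H (S n)); assert (0 <= u (S n)) by (apply H; lia); lra.
Qed.

Lemma sum_n_zero (u : nat -> R) (n : nat) :
  (forall k, (k <= n)%nat -> u k = 0) -> sum_n u n = 0 :> R.
Proof.
  intros H; induction n as [|n IH].
  - rewrite sum_n_OR; apply H; lia.
  - rewrite sum_n_SR, IH by (intros; apply H; lia). rewrite H by lia; ring.
Qed.

Lemma sum_n_single (u : nat -> R) (n i : nat) :
  (i <= n)%nat -> (forall k, (k <= n)%nat -> k <> i -> u k = 0) -> sum_n u n = u i :> R.
Proof.
  induction n as [|n IH]; intros Hi H.
  - replace i with 0%nat by lia; apply sum_n_OR.
  - rewrite sum_n_SR.
    destruct (Nat.eq_dec i (S n)) as [->|Hn].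
    + rewrite sum_n_zero by (intros; apply H; lia); ring.
    + rewrite IH; [|lia|intros; apply H; lia]. rewrite (H (S n)) by lia; ring.
Qed.

Lemma Cauchy_Schwarz_sum_n (u v : nat -> R) (n : nat) :
  sum_n (fun k => u k * v k) n ^ 2
    <= sum_n (fun k => u k ^ 2) n * sum_n (fun k => v k ^ 2) n.
Proof.
  induction n as [|n IH].
  - rewrite !sum_n_OR; right; ring.
  - rewrite !sum_n_SR.
    set (X := sum_n (fun k => u k * v k) n) in *.
    assert (HU : 0 <= sum_n (fun k => u k ^ 2) n)
      by (apply sum_n_nonneg; intros; apply pow2_ge_0).
    assert (HV : 0 <= sum_n (fun k => v k ^ 2) n)
      by (apply sum_n_nonneg; intros; apply pow2_ge_0).
    set (U := sum_n (fun k => u k ^ 2) n) in *.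
    set (V := sum_n (fun k => v k ^ 2) n) in *.
    set (a := u (S n)); set (b := v (S n)).
    (* (2 X a b)^2 <= 4 (U b^2) (V a^2) <= (U b^2 + V a^2)^2 *)
    assert (H : 2 * X * (a * b) <= U * b ^ 2 + V * a ^ 2).
    { apply Rsqr_incr_0_var; [unfold Rsqr|nra].
      assert (X ^ 2 * (a * b) ^ 2 <= U * V * (a * b) ^ 2)
        by (apply Rmult_le_compat_r; [apply pow2_ge_0|exact IH]).
      assert (0 <= (U * b ^ 2 - V * a ^ 2) ^ 2) by apply pow2_ge_0.
      nra. }
    nra.
Qed.

Lemma sum_n_le_Series (u : nat -> R) (n : nat) :
  (forall k, 0 <= u k) -> ex_series u -> sum_n u n <= Series u.
Proof.
  intros H Hu.
  apply (is_lim_seq_incr_compare (sum_n u) (Series u)).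
  - exact (Series_correct u Hu).
  - intros k; rewrite sum_n_SR; specialize (H (S k)); lra.
Qed.

Lemma Series_le_bound (u : nat -> R) (B : R) :
  ex_series u -> (forall n, sum_n u n <= B) -> Series u <= B.
Proof.
  intros Hu H.
  apply (is_lim_seq_le (sum_n u) (fun _ => B) (Series u) B H).
  - exact (Series_correct u Hu).
  - apply is_lim_seq_const.
Qed.

Lemma ex_series_bounded (u : nat -> R) (B : R) :
  (forall k, 0 <= u k) -> (forall n, sum_n u n <= B) -> ex_series u.
Proof.
  intros H HB.
  destruct (ex_finite_lim_seq_incr (sum_n u) B) as [l Hl].
  - intros k; rewrite sum_n_SR; specialize (H (S k)); lra.
  - exact HB.
  - exists l; exact Hl.
Qed.

Lemma ex_series_le_R (u v : nat -> R) :
  (forall k, 0 <= u k <= v k) -> ex_series v -> ex_series u.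
Proof.
  intros H Hv; apply (ex_series_le u v); [|exact Hv].
  intros k; change (norm (u k)) with (Rabs (u k)); specialize (H k).
  rewrite Rabs_pos_eq; lra.
Qed.

Lemma is_series_finite (u : nat -> R) (n : nat) :
  (forall k, (n < k)%nat -> u k = 0) -> is_series u (sum_n u n).
Proof.
  intros H.
  change (is_lim_seq (sum_n u) (Finite (sum_n u n))).
  apply (is_lim_seq_ext_loc (fun _ => sum_n u n)); [|apply is_lim_seq_const].
  exists n; intros m; induction 1 as [|m Hm IH]; [reflexivity|].
  rewrite sum_n_SR, <- IH, H by lia; apply eq_sym, Rplus_0_r.
Qed.

Lemma sum_n_m_shift {G : AbelianMonoid} (u : nat -> G) (N k : nat) :
  sum_n_m u N (N + k) = sum_n (fun i => u (N + i)%nat) k.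
Proof.
  unfold sum_n; induction k as [|k IH].
  - rewrite Nat.add_0_r, !sum_n_n, Nat.add_0_r; reflexivity.
  - rewrite Nat.add_succ_r, !sum_n_Sm by lia.
    rewrite IH, Nat.add_succ_r; reflexivity.
Qed.

(** * The Schur test *)

Section Schur.

Variables (K : nat -> nat -> R) (w : nat -> R) (C : R).
Hypothesis K_nonneg : forall i j, 0 <= K i j.
Hypothesis K_sym : forall i j, K i j = K j i.
Hypothesis w_pos : forall i, 0 < w i.
Hypothesis K_w : forall n i, sum_n (fun j => K i j * w j) n <= C * w i.

(** Cauchy-Schwarz with [K u] split as sqrt (K w) times sqrt (K / w) u. The weight hypothesis bounds
    the first factor; after the sums are exchanged, symmetry lets the same hypothesis bound the
    second. Rows and columns are truncated independently so that the number of columns can later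
    tend to infinity alone. *)
Lemma Schur_test (u : nat -> R) (n m : nat) :
  sum_n (fun i => sum_n (fun j => K i j * u j) m ^ 2) n
    <= C ^ 2 * sum_n (fun j => u j ^ 2) m.
Proof.
  assert (HC : 0 <= C).
  { assert (H : 0 <= C * w 0) by (eapply Rle_trans; [|apply (K_w 0)];
      rewrite sum_n_OR; apply Rmult_le_pos; [apply K_nonneg|left; apply w_pos]).
    specialize (w_pos 0%nat); nra. }
  apply Rle_trans with
    (sum_n (fun i => C * w i * sum_n (fun j => K i j * (u j ^ 2 / w j)) m) n).
  { apply sum_n_le_loc; intros i _.
    assert (Hs : forall j, 0 < sqrt (w j)) by (intros; apply sqrt_lt_R0, w_pos).
    assert (Hw : forall j, sqrt (w j) ^ 2 = w j)
      by (intros j; rewrite pow2_sqrt; [|left; apply w_pos]; reflexivity).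
    assert (HK : forall j, sqrt (K i j) ^ 2 = K i j)
      by (intros j; rewrite pow2_sqrt; [|apply K_nonneg]; reflexivity).
    rewrite (sum_n_extR _ (fun j => (sqrt (K i j) * sqrt (w j))
                                     * (sqrt (K i j) * (u j / sqrt (w j))))).
    2:{ intros j; rewrite <- (HK j) at 1; field; apply Rgt_not_eq, Hs. }
    eapply Rle_trans; [apply Cauchy_Schwarz_sum_n|].
    rewrite (sum_n_extR _ (fun j => K i j * w j)).
    2:{ intros j; rewrite <- (HK j) at 2; rewrite <- (Hw j) at 2; ring. }
    rewrite (sum_n_extR (fun j => (sqrt (K i j) * (u j / sqrt (w j))) ^ 2)
               (fun j => K i j * (u j ^ 2 / w j))).
    2:{ intros j; rewrite <- (HK j) at 2; rewrite <- (Hw j) at 2; field; apply Rgt_not_eq, Hs. }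
    apply Rmult_le_compat_r; [|apply K_w].
    apply sum_n_nonneg; intros j _; apply Rmult_le_pos; [apply K_nonneg|].
    apply Rdiv_le_0_compat; [apply pow2_ge_0|apply w_pos]. }
  rewrite (sum_n_extR _ (fun i => sum_n (fun j => C * w i * (K i j * (u j ^ 2 / w j))) m))
    by (intros; rewrite sum_n_scalR; reflexivity).
  rewrite sum_n_switch, <- sum_n_scalR.
  apply sum_n_le_loc; intros j _.
  rewrite (sum_n_extR _ (fun i => C * (u j ^ 2 / w j) * (K j i * w i)))
    by (intros; rewrite K_sym; ring).
  rewrite sum_n_scalR.
  replace (C ^ 2 * u j ^ 2) with (C * (u j ^ 2 / w j) * (C * w j))
    by (field; apply Rgt_not_eq, w_pos).
  apply Rmult_le_compat_l; [|apply K_w].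
  apply Rmult_le_pos; [exact HC|].
  apply Rdiv_le_0_compat; [apply pow2_ge_0|apply w_pos].
Qed.

End Schur.

(** * The model kernel [q_i q_j min(p_i, p_j)^2] *)

Section Model_kernel.

Variables (q p : nat -> R) (C : R).
Hypothesis q_pos : forall i, 0 < q i.
Hypothesis p_pos : forall i, 0 < p i.
Hypothesis p_decr : forall i, p (S i) <= p i.
Hypothesis growth : forall n, sum_n (fun j => q j ^ 2) n * p n ^ 2 <= C.

(** Since [p] decreases, the minimum is [p] at the larger index. Row i is thus [q j] times a
    constant up to the diagonal and [q j * p j ^ 2] times a constant beyond it, which reduces the
    Schur sums to one-variable sums. *)
Definition model_kernel (i j : nat) : R := q i * q j * Rmin (p i) (p j) ^ 2.

Let A (n : nat) : R := sum_n (fun j => q j ^ 2) n.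

Lemma p_antitone (i j : nat) : (i <= j)%nat -> p j <= p i.
Proof. induction 1 as [|j _ IH]; [lra|]. specialize (p_decr j); lra. Qed.

Lemma growth_const_nonneg : 0 <= C.
Proof.
  eapply Rle_trans; [|apply (growth 0)].
  apply Rmult_le_pos; [|apply pow2_ge_0].
  apply sum_n_nonneg; intros; apply pow2_ge_0.
Qed.

(* Summation by parts, with the inductive invariant [A n * p n + C / p n]. *)
Lemma model_head (n : nat) : sum_n (fun j => q j ^ 2 * p j) n <= 2 * C / p n.
Proof.
  assert (HC := growth_const_nonneg).
  assert (H : sum_n (fun j => q j ^ 2 * p j) n <= A n * p n + C / p n).
  { induction n as [|n IH].
    - unfold A; rewrite !sum_n_OR.
      assert (0 <= C / p 0%nat) by (apply Rdiv_le_0_compat; [exact HC|apply p_pos]); lra.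
    - rewrite sum_n_SR; unfold A in *; rewrite sum_n_SR.
      fold (A n) in *.
      assert (Hp := p_pos n); assert (Hp' := p_pos (S n)); assert (Hd := p_decr n).
      assert (Hg := growth n); fold (A n) in Hg.
      assert (Hk : A n * (p n - p (S n)) <= C / p (S n) - C / p n).
      { replace (C / p (S n) - C / p n) with (C / (p n * p (S n)) * (p n - p (S n)))
          by (field; lra).
        apply Rmult_le_compat_r; [lra|].
        apply (Rmult_le_reg_r (p n * p (S n))); [nra|].
        replace (C / (p n * p (S n)) * (p n * p (S n))) with C by (field; lra).
        eapply Rle_trans; [|exact Hg].
        apply Rmult_le_compat_l; [|nra].
        apply sum_n_nonneg; intros; apply pow2_ge_0. }
      lra. }
  eapply Rle_trans; [exact H|].
  assert (Hp := p_pos n); assert (Hg := growth n); fold (A n) in Hg.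
  apply (Rmult_le_reg_r (p n)); [exact Hp|].
  replace (2 * C / p n * p n) with (2 * C) by (field; lra).
  replace ((A n * p n + C / p n) * p n) with (A n * p n ^ 2 + C) by (field; lra).
  lra.
Qed.

(** Summation by parts again: [A n * (p n ^ 3 - p (S n) ^ 3)] is at most 3 A n (p n)^2 (p n - p (S
    n)), hence at most 3 C (p n - p (S n)), and this telescopes. The boundary term is absorbed by
    the negative end of the telescoping sum. *)
Lemma model_tail (i m : nat) :
  sum_n (fun j => q j ^ 2 * p j ^ 3) (i + m)
    - sum_n (fun j => q j ^ 2 * p j ^ 3) i <= 3 * C * p i.
Proof.
  assert (HC := growth_const_nonneg).
  assert (H : sum_n (fun j => q j ^ 2 * p j ^ 3) (i + m)
      - sum_n (fun j => q j ^ 2 * p j ^ 3) i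
      <= A (i + m) * p (i + m)%nat ^ 3 + 3 * C * (p i - p (i + m)%nat)).
  { induction m as [|m IH].
    - rewrite Nat.add_0_r.
      assert (0 <= A i * p i ^ 3).
      { apply Rmult_le_pos; [apply sum_n_nonneg; intros; apply pow2_ge_0|].
        apply pow_le; left; apply p_pos. }
      lra.
    - rewrite Nat.add_succ_r; set (n := (i + m)%nat) in *.
      rewrite (sum_n_SR _ n); unfold A in *; rewrite sum_n_SR; fold (A n) in *.
      assert (Hp := p_pos n); assert (Hp' := p_pos (S n)); assert (Hd := p_decr n).
      assert (Hg := growth n); fold (A n) in Hg.
      assert (HA : 0 <= A n) by (apply sum_n_nonneg; intros; apply pow2_ge_0).
      assert (Hk : A n * (p n ^ 3 - p (S n) ^ 3) <= 3 * C * (p n - p (S n))).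
      { replace (A n * (p n ^ 3 - p (S n) ^ 3))
          with (A n * (p n ^ 2 + p n * p (S n) + p (S n) ^ 2) * (p n - p (S n))) by ring.
        apply Rmult_le_compat_r; [lra|].
        apply Rle_trans with (A n * (3 * p n ^ 2)); [|lra].
        apply Rmult_le_compat_l; [exact HA|nra]. }
      lra. }
  eapply Rle_trans; [exact H|].
  assert (Hp := p_pos (i + m)%nat); assert (Hg := growth (i + m)); fold (A (i + m)) in Hg.
  replace (A (i + m) * p (i + m)%nat ^ 3)
    with (A (i + m) * p (i + m)%nat ^ 2 * p (i + m)%nat) by ring.
  nra.
Qed.

Lemma model_kernel_nonneg (i j : nat) : 0 <= model_kernel i j.
Proof.
  apply Rmult_le_pos; [|apply pow2_ge_0].
  left; apply Rmult_lt_0_compat; apply q_pos.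
Qed.

(** The weight [q * p] balances the two sides of the diagonal: the head contributes q_i p_i^2 (2 C /
    p_i), the tail q_i (3 C p_i), whence 5 C. *)
Lemma model_kernel_weight (n i : nat) :
  sum_n (fun j => model_kernel i j * (q j * p j)) n <= 5 * C * (q i * p i).
Proof.
  assert (HC := growth_const_nonneg).
  assert (Hterm : forall j, 0 <= model_kernel i j * (q j * p j)).
  { intros j; apply Rmult_le_pos; [apply model_kernel_nonneg|].
    left; apply Rmult_lt_0_compat; auto. }
  (* Lengthening the sum past i allows splitting at the diagonal without a case distinction on n. *)
  apply Rle_trans with (sum_n (fun j => model_kernel i j * (q j * p j)) (i + n)).
  { apply sum_n_mono; [exact Hterm|lia]. }
  assert (Hhead : forall m, (m <= i)%nat ->
     sum_n (fun j => model_kernel i j * (q j * p j)) m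
     = q i * p i ^ 2 * sum_n (fun j => q j ^ 2 * p j) m :> R).
  { intros m Hm; rewrite <- sum_n_scalR; apply sum_n_ext_locR; intros j Hj.
    unfold model_kernel; rewrite Rmin_left by (apply p_antitone; lia); ring. }
  assert (Htail : forall m,
     sum_n (fun j => model_kernel i j * (q j * p j)) (i + m)
     = sum_n (fun j => model_kernel i j * (q j * p j)) i
       + q i * (sum_n (fun j => q j ^ 2 * p j ^ 3) (i + m)
                - sum_n (fun j => q j ^ 2 * p j ^ 3) i) :> R).
  { induction m as [|m IH].
    - rewrite Nat.add_0_r; lra.
    - rewrite Nat.add_succ_r, !sum_n_SR, IH.
      assert (Hm : model_kernel i (S (i + m)) = q i * q (S (i + m)) * p (S (i + m)) ^ 2)
        by (unfold model_kernel; rewrite Rmin_right by (apply p_antitone; lia); reflexivity).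
      rewrite Hm; ring. }
  rewrite Htail, Hhead by lia.
  assert (Hq := q_pos i); assert (Hp := p_pos i).
  assert (q i * p i ^ 2 * sum_n (fun j => q j ^ 2 * p j) i <= q i * p i ^ 2 * (2 * C / p i)).
  { apply Rmult_le_compat_l; [apply Rmult_le_pos; [lra|apply pow2_ge_0]|apply model_head]. }
  replace (q i * p i ^ 2 * (2 * C / p i)) with (2 * C * (q i * p i)) in H by (field; lra).
  assert (q i * (sum_n (fun j => q j ^ 2 * p j ^ 3) (i + n)
                - sum_n (fun j => q j ^ 2 * p j ^ 3) i) <= q i * (3 * C * p i)).
  { apply Rmult_le_compat_l; [lra|apply model_tail]. }
  lra.
Qed.

Lemma model_kernel_bound (u : nat -> R) (n m : nat) :
  sum_n (fun i => sum_n (fun j => model_kernel i j * u j) m ^ 2) n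
    <= (5 * C) ^ 2 * sum_n (fun j => u j ^ 2) m.
Proof.
  apply (Schur_test model_kernel (fun i => q i * p i)).
  - apply model_kernel_nonneg.
  - intros i j; unfold model_kernel; rewrite Rmin_comm; ring.
  - intros i; apply Rmult_lt_0_compat; auto.
  - intros k i; apply model_kernel_weight.
Qed.

End Model_kernel.


(** * The zeta function on the real axis *)

Definition npow (n : nat) (x : R) : R := exp (- x * ln (INR n)).

Definition zetaR (x : R) : R := Series (fun k => npow (S k) x).

Lemma INR_S_pos (n : nat) : 0 < INR (S n).
Proof. apply lt_0_INR; lia. Qed.

Lemma exp_le_compat (x y : R) : x <= y -> exp x <= exp y.
Proof. intros [H|H]; [left; apply exp_increasing, H|rewrite H; lra]. Qed.

Lemma npow_pos (n : nat) (x : R) : 0 < npow n x.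
Proof. apply exp_pos. Qed.

Lemma npow_1 (x : R) : npow 1 x = 1.
Proof. unfold npow; simpl INR; rewrite ln_1, Rmult_0_r; apply exp_0. Qed.

Lemma npow_mult (m n : nat) (x : R) :
  (0 < m)%nat -> (0 < n)%nat -> npow (m * n) x = npow m x * npow n x.
Proof.
  intros Hm Hn; unfold npow; rewrite <- exp_plus, mult_INR, ln_mult by (apply lt_0_INR; lia).
  f_equal; ring.
Qed.

Lemma npow_plus (n : nat) (x y : R) : npow n (x + y) = npow n x * npow n y.
Proof. unfold npow; rewrite <- exp_plus; f_equal; ring. Qed.

Lemma npow_antitone (m n : nat) (x : R) :
  (0 < m)%nat -> (m <= n)%nat -> 0 <= x -> npow n x <= npow m x.
Proof.
  intros Hm Hmn Hx; unfold npow.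
  assert (Hl : ln (INR m) <= ln (INR n)).
  { apply ln_le; [apply lt_0_INR; lia|apply le_INR; lia]. }
  apply exp_le_compat; nra.
Qed.

Lemma npow_le_1 (n : nat) (x : R) : (0 < n)%nat -> 0 <= x -> npow n x <= 1.
Proof. intros Hn Hx; rewrite <- (npow_1 x); apply npow_antitone; lia || lra. Qed.

Lemma npow_pow (q k : nat) (x : R) : (0 < q)%nat -> npow (q ^ k) x = npow q x ^ k.
Proof.
  intros Hq; induction k as [|k IH]; simpl.
  - apply npow_1.
  - rewrite npow_mult, IH; [reflexivity|lia|].
    apply Nat.neq_0_lt_0, Nat.pow_nonzero; lia.
Qed.

Lemma npow_one (n : nat) : (0 < n)%nat -> npow n 1 = / INR n.
Proof.
  intros Hn; unfold npow.
  replace (- (1) * ln (INR n)) with (- ln (INR n)) by ring.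
  rewrite exp_Ropp, exp_ln by (apply lt_0_INR; lia); reflexivity.
Qed.

Lemma ln_le_sub_1 (x : R) : 0 < x -> ln x <= x - 1.
Proof.
  intros Hx; assert (H := exp_ineq1_le (ln x)); rewrite exp_ln in H by exact Hx; lra.
Qed.

(** The mean value estimate for t^(-s) on [k, k+1], obtained from 1/(k+1) <= ln (k+1) - ln k <= 1/k
    and exp t >= 1 + t. Telescoping its two halves compares zeta (1+s) with 1/s from both sides. *)
Lemma npow_diff (k : nat) (s : R) : 0 < s -> (0 < k)%nat ->
  s * npow (S k) (1 + s) <= npow k s - npow (S k) s <= s * npow k (1 + s).
Proof.
  intros Hs Hk.
  assert (HK : 0 < INR k) by (apply lt_0_INR; lia).
  assert (HSk := INR_S_pos k).
  set (r := ln (INR (S k)) - ln (INR k)).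
  assert (Hr1 : / INR (S k) <= r).
  { assert (H := ln_le_sub_1 (INR k / INR (S k)) (Rdiv_lt_0_compat _ _ HK HSk)).
    rewrite ln_div in H by assumption.
    replace (INR k / INR (S k) - 1) with (- / INR (S k)) in H
      by (rewrite S_INR in *; field; lra).
    unfold r; lra. }
  assert (Hr2 : r <= / INR k).
  { assert (H := ln_le_sub_1 (INR (S k) / INR k) (Rdiv_lt_0_compat _ _ HSk HK)).
    rewrite ln_div in H by assumption.
    replace (INR (S k) / INR k - 1) with (/ INR k) in H
      by (rewrite S_INR in *; field; lra).
    unfold r; lra. }
  rewrite !npow_plus, !npow_one by lia.
  assert (E1 : npow k s = npow (S k) s * exp (s * r))
    by (unfold npow; rewrite <- exp_plus; f_equal; unfold r; ring).
  assert (E2 : npow (S k) s = npow k s * exp (- (s * r)))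
    by (unfold npow; rewrite <- exp_plus; f_equal; unfold r; ring).
  assert (P1 := npow_pos k s); assert (P2 := npow_pos (S k) s).
  split.
  - rewrite E1.
    assert (H := exp_ineq1_le (s * r)).
    assert (s * / INR (S k) <= s * r) by (apply Rmult_le_compat_l; lra).
    nra.
  - rewrite E2.
    assert (H := exp_ineq1_le (- (s * r))).
    assert (s * r <= s * / INR k) by (apply Rmult_le_compat_l; lra).
    nra.
Qed.

Lemma zeta_partial_le (n : nat) (s : R) : 0 < s ->
  sum_n (fun k => npow (S k) (1 + s)) n <= 1 + / s.
Proof.
  intros Hs.
  (* The term k = 0 contributes s; the remaining ones telescope. *)
  assert (H : s * sum_n (fun k => npow (S k) (1 + s)) n <= s + 1 - npow (S n) s).
  { induction n as [|n IH].
    - rewrite sum_n_OR, !npow_1; lra.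
    - rewrite sum_n_SR.
      assert (H := npow_diff (S n) s Hs ltac:(lia)); lra. }
  apply (Rmult_le_reg_l s); [exact Hs|].
  replace (s * (1 + / s)) with (s + 1) by (field; lra).
  assert (P := npow_pos (S n) s); lra.
Qed.

Lemma zeta_ex_series (x : R) : 1 < x -> ex_series (fun k => npow (S k) x).
Proof.
  intros Hx; apply (ex_series_bounded _ (1 + / (x - 1))).
  - intros; left; apply npow_pos.
  - intros n; assert (H := zeta_partial_le n (x - 1) ltac:(lra)).
    replace (1 + (x - 1)) with x in H by ring; exact H.
Qed.

Lemma zetaR_le (s : R) : 0 < s -> zetaR (1 + s) <= 1 + / s.
Proof.
  intros Hs; apply Series_le_bound; [apply zeta_ex_series; lra|].
  intros n; apply zeta_partial_le, Hs.
Qed.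

Lemma zetaR_ge_1 (x : R) : 1 < x -> 1 <= zetaR x.
Proof.
  intros Hx; rewrite <- (npow_1 x).
  assert (H := sum_n_le_Series (fun k => npow (S k) x) 0
    (fun k => Rlt_le _ _ (npow_pos _ _)) (zeta_ex_series x Hx)).
  rewrite sum_n_OR in H; exact H.
Qed.

Lemma zetaR_ge (s : R) : 0 < s -> / s <= zetaR (1 + s).
Proof.
  intros Hs.
  assert (Hn : forall n, 1 - npow (S (S n)) s <= s * zetaR (1 + s)).
  { intros n.
    apply Rle_trans with (s * sum_n (fun k => npow (S k) (1 + s)) n).
    - induction n as [|n IH].
      + rewrite sum_n_OR; assert (H := npow_diff 1 s Hs ltac:(lia)).
        rewrite !npow_1 in H; rewrite !npow_1; lra.
      + rewrite sum_n_SR; assert (H := npow_diff (S (S n)) s Hs ltac:(lia)); lra.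
    - apply Rmult_le_compat_l; [lra|].
      apply sum_n_le_Series; [intros; left; apply npow_pos|apply zeta_ex_series; lra]. }
  apply (Rmult_le_reg_l s); [exact Hs|]; rewrite Rinv_r by lra.
  destruct (Rle_or_lt 1 (s * zetaR (1 + s))) as [H|H]; [exact H|exfalso].
  (* If the bound failed by [del], some n with s ln (n+2) >= 1/del would make (n+2)^(-s) smaller
     than [del], against [Hn]. *)
  set (del := 1 - s * zetaR (1 + s)) in *.
  destruct (INR_unbounded (exp (/ (s * del)))) as [n Hn'].
  specialize (Hn n).
  assert (Hd : 0 < del) by (unfold del; lra).
  assert (Hsd : 0 < s * del) by nra.
  assert (Hl : / (s * del) <= ln (INR (S (S n)))).
  { rewrite <- (ln_exp (/ (s * del))); apply ln_le; [apply exp_pos|].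
    rewrite !S_INR; lra. }
  assert (H1 := exp_ineq1_le (s * ln (INR (S (S n))))).
  assert (H2 : s * / (s * del) <= s * ln (INR (S (S n)))) by (apply Rmult_le_compat_l; lra).
  replace (s * / (s * del)) with (/ del) in H2 by (field; lra).
  assert (H3 : npow (S (S n)) s * exp (s * ln (INR (S (S n)))) = 1).
  { unfold npow; rewrite <- exp_plus, <- exp_0; f_equal; ring. }
  assert (P := npow_pos (S (S n)) s).
  assert (H4 : / del < exp (s * ln (INR (S (S n))))) by lra.
  assert (H5 : npow (S (S n)) s < del).
  { apply (Rmult_lt_reg_r (/ del)); [apply Rinv_0_lt_compat; lra|].
    rewrite Rinv_r by lra; nra. }
  unfold del in H5; lra.
Qed.

(** * Asymptotic Dirichlet expansions at infinity *)

(* Coefficients are indexed by n = 1, ..., N + 1, and the error is of the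
   order of the first omitted term. *)
Definition expands (N : nat) (F : R -> R) (a : nat -> R) : Prop :=
  exists B x0 : R, forall x, x0 <= x ->
    Rabs (F x - sum_n (fun k => a (S k) * npow (S k) x) N) <= B * npow (S (S N)) x.

(** Dirichlet convolution, written as a double sum over factors up to N + 1 instead of over
    divisors, so that products of partial sums expand into it directly. It is the exact convolution
    for 1 <= n <= N + 1. *)
Definition conv (N : nat) (a b : nat -> R) (n : nat) : R :=
  sum_n (fun i => sum_n (fun j =>
    if Nat.eqb (S i * S j) n then a (S i) * b (S j) else 0) N) N.

Lemma expands_ext (N : nat) (F G : R -> R) (a b : nat -> R) (x1 : R) :
  (forall x, x1 <= x -> F x = G x) -> (forall n, (1 <= n <= S N)%nat -> a n = b n) ->
  expands N F a -> expands N G b.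
Proof.
  intros HF Ha [B [x0 H]]; exists B, (Rmax x0 x1); intros x Hx.
  rewrite <- HF by (eapply Rle_trans; [apply Rmax_r|exact Hx]).
  rewrite (sum_n_ext_locR _ (fun k => a (S k) * npow (S k) x))
    by (intros; rewrite Ha by lia; reflexivity).
  apply H; eapply Rle_trans; [apply Rmax_l|exact Hx].
Qed.

Lemma expands_minus (N : nat) (F G : R -> R) (a b : nat -> R) :
  expands N F a -> expands N G b ->
  expands N (fun x => F x - G x) (fun n => a n - b n).
Proof.
  intros [B [x0 H]] [B' [x0' H']]; exists (B + B'), (Rmax x0 x0'); intros x Hx.
  specialize (H x ltac:(eapply Rle_trans; [apply Rmax_l|exact Hx])).
  specialize (H' x ltac:(eapply Rle_trans; [apply Rmax_r|exact Hx])).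
  rewrite (sum_n_extR _ (fun k => a (S k) * npow (S k) x - b (S k) * npow (S k) x))
    by (intros; ring).
  rewrite sum_n_minusR.
  set (s := sum_n _ N) in H |- *; set (t := sum_n _ N) in H' |- *.
  replace (F x - G x - (s - t)) with ((F x - s) - (G x - t)) by ring.
  eapply Rle_trans; [apply Rabs_triang|]; rewrite Rabs_Ropp; lra.
Qed.

Lemma dirichlet_poly_bound (N : nat) (a : nat -> R) (x : R) : 0 <= x ->
  Rabs (sum_n (fun k => a (S k) * npow (S k) x) N) <= sum_n (fun k => Rabs (a (S k))) N.
Proof.
  intros Hx; eapply Rle_trans; [apply sum_n_Rabs|].
  apply sum_n_le_loc; intros k _.
  rewrite Rabs_mult, (Rabs_pos_eq (npow _ _)) by (left; apply npow_pos).
  assert (H := npow_le_1 (S k) x ltac:(lia) Hx); assert (P := Rabs_pos (a (S k))); nra.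
Qed.

(** The difference consists of the pairs of indices whose product is at least N + 2; each of them is
    at most its coefficient times (N+2)^(-x). *)
Lemma dirichlet_poly_mult (N : nat) (a b : nat -> R) (x : R) : 0 <= x ->
  Rabs (sum_n (fun k => a (S k) * npow (S k) x) N * sum_n (fun k => b (S k) * npow (S k) x) N
        - sum_n (fun k => conv N a b (S k) * npow (S k) x) N)
  <= sum_n (fun k => Rabs (a (S k))) N * sum_n (fun k => Rabs (b (S k))) N * npow (S (S N)) x.
Proof.
  intros Hx.
  set (ex i j := if Nat.leb (S i * S j) (S N) then 0
                 else a (S i) * b (S j) * npow (S i * S j) x).
  assert (E : sum_n (fun k => a (S k) * npow (S k) x) N * sum_n (fun k => b (S k) * npow (S k) x) N
        - sum_n (fun k => conv N a b (S k) * npow (S k) x) N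
        = sum_n (fun i => sum_n (fun j => ex i j) N) N).
  { rewrite <- sum_n_scalR_r.
    rewrite (sum_n_extR (fun k => conv N a b (S k) * npow (S k) x)
      (fun k => sum_n (fun i => sum_n (fun j =>
         (if Nat.eqb (S i * S j) (S k) then a (S i) * b (S j) else 0) * npow (S k) x) N) N)).
    2:{ intros k; unfold conv; rewrite <- sum_n_scalR_r; apply sum_n_extR; intros i.
        rewrite <- sum_n_scalR_r; reflexivity. }
    rewrite sum_n_switch, <- sum_n_minusR; apply sum_n_extR; intros i.
    rewrite sum_n_switch, <- sum_n_scalR, <- sum_n_minusR; apply sum_n_extR; intros j.
    replace (a (S i) * npow (S i) x * (b (S j) * npow (S j) x))
      with (a (S i) * b (S j) * npow (S i * S j) x) by (rewrite npow_mult by lia; ring).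
    unfold ex; destruct (Nat.leb_spec (S i * S j) (S N)) as [Hl|Hl].
    - rewrite (sum_n_single _ N (S i * S j - 1)); [|lia|].
      + replace (S (S i * S j - 1)) with (S i * S j)%nat by lia.
        rewrite Nat.eqb_refl; ring.
      + intros k Hk Hne; destruct (Nat.eqb_spec (S i * S j) (S k)); [lia|ring].
    - rewrite sum_n_zero; [ring|].
      intros k Hk; destruct (Nat.eqb_spec (S i * S j) (S k)); [lia|ring]. }
  rewrite E; eapply Rle_trans; [apply sum_n_Rabs|].
  rewrite Rmult_assoc, <- sum_n_scalR_r; apply sum_n_le_loc; intros i _.
  eapply Rle_trans; [apply sum_n_Rabs|].
  rewrite <- sum_n_scalR_r, <- sum_n_scalR; apply sum_n_le_loc; intros j _.
  assert (P1 := Rabs_pos (a (S i))); assert (P2 := Rabs_pos (b (S j))).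
  assert (P3 := npow_pos (S (S N)) x).
  unfold ex; destruct (Nat.leb_spec (S i * S j) (S N)) as [Hl|Hl].
  - rewrite Rabs_R0; apply Rmult_le_pos; [lra|apply Rmult_le_pos; lra].
  - rewrite !Rabs_mult, (Rabs_pos_eq (npow _ _)) by (left; apply npow_pos).
    rewrite Rmult_assoc; apply Rmult_le_compat_l; [lra|].
    apply Rmult_le_compat_l; [lra|]. apply npow_antitone; lia || lra.
Qed.

Lemma expands_mult (N : nat) (F G : R -> R) (a b : nat -> R) :
  expands N F a -> expands N G b -> expands N (fun x => F x * G x) (conv N a b).
Proof.
  intros [B [x0 H]] [B' [x0' H']].
  set (SA := sum_n (fun k => Rabs (a (S k))) N).
  set (SB := sum_n (fun k => Rabs (b (S k))) N).
  exists (SA * SB + SA * B' + B * SB + B * B'), (Rmax 0 (Rmax x0 x0')); intros x Hx.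
  assert (Hx0 : 0 <= x) by (eapply Rle_trans; [apply Rmax_l|exact Hx]).
  assert (Hx' : Rmax x0 x0' <= x) by (eapply Rle_trans; [apply Rmax_r|exact Hx]).
  specialize (H x ltac:(eapply Rle_trans; [apply Rmax_l|exact Hx'])).
  specialize (H' x ltac:(eapply Rle_trans; [apply Rmax_r|exact Hx'])).
  assert (HP := dirichlet_poly_mult N a b x Hx0); fold SA SB in HP.
  assert (HA := dirichlet_poly_bound N a x Hx0); fold SA in HA.
  assert (HB := dirichlet_poly_bound N b x Hx0); fold SB in HB.
  set (P := sum_n (fun k => a (S k) * npow (S k) x) N) in *.
  set (Q := sum_n (fun k => b (S k) * npow (S k) x) N) in *.
  set (T := sum_n (fun k => conv N a b (S k) * npow (S k) x) N) in *.
  assert (Hv := npow_pos (S (S N)) x).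
  assert (Hv1 := npow_le_1 (S (S N)) x ltac:(lia) Hx0).
  set (v := npow (S (S N)) x) in *.
  set (r := F x - P) in *; set (t := G x - Q) in *.
  replace (F x * G x - T) with ((P * Q - T) + (P * t + r * Q + r * t))
    by (unfold r, t; ring).
  eapply Rle_trans; [apply Rabs_triang|].
  assert (Rabs (P * t + r * Q + r * t) <= Rabs P * Rabs t + Rabs r * Rabs Q + Rabs r * Rabs t).
  { rewrite <- !Rabs_mult; eapply Rle_trans; [apply Rabs_triang|].
    apply Rplus_le_compat_r, Rabs_triang. }
  assert (R1 := Rabs_pos r); assert (R2 := Rabs_pos t).
  assert (R3 := Rabs_pos P); assert (R4 := Rabs_pos Q).
  assert (Rabs P * Rabs t <= SA * (B' * v)) by (apply Rmult_le_compat; lra).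
  assert (Rabs r * Rabs Q <= (B * v) * SB) by (apply Rmult_le_compat; lra).
  assert (Rabs r * Rabs t <= (B * v) * B').
  { apply Rmult_le_compat; try lra. nra. }
  nra.
Qed.

(** The ratio ((k+2)/(k+1))^x of consecutive monomials is unbounded in x, so a nonzero coefficient
    is visible above any error of the next order. *)
Lemma npow_gap (k : nat) (B del x0 : R) : 0 < del ->
  exists x, x0 <= x /\ B * npow (S (S k)) x < del * npow (S k) x.
Proof.
  intros Hd.
  set (r := ln (INR (S (S k))) - ln (INR (S k))).
  assert (Hr : 0 < r).
  { unfold r; assert (ln (INR (S k)) < ln (INR (S (S k)))); [|lra].
    apply ln_increasing; [apply INR_S_pos|apply lt_INR; lia]. }
  set (x := Rmax x0 (Rmax 0 (B / del / r))).
  exists x; split; [apply Rmax_l|].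
  assert (Hx : B / del / r <= x)
    by (eapply Rle_trans; [apply Rmax_r|]; apply Rmax_r).
  assert (E : npow (S k) x = npow (S (S k)) x * exp (x * r))
    by (unfold npow; rewrite <- exp_plus; f_equal; unfold r; ring).
  assert (H := exp_ineq1_le (x * r)).
  assert (Hb : B / del <= x * r).
  { replace (B / del) with (B / del / r * r) by (field; lra).
    apply Rmult_le_compat_r; lra. }
  assert (Hb' : B <= del * (x * r)).
  { replace B with (del * (B / del)) by (field; lra). apply Rmult_le_compat_l; lra. }
  assert (P := npow_pos (S (S k)) x).
  assert (Hc : B < del * exp (x * r)) by nra.
  rewrite E, (Rmult_comm (npow _ _)), <- Rmult_assoc.
  apply Rmult_lt_compat_r; lra.
Qed.

Lemma expands_trunc (N : nat) (F : R -> R) (a : nat -> R) :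
  expands (S N) F a -> expands N F a.
Proof.
  intros [B [x0 H]]; exists (Rabs B + Rabs (a (S (S N)))), (Rmax 0 x0); intros x Hx.
  assert (Hx0 : 0 <= x) by (eapply Rle_trans; [apply Rmax_l|exact Hx]).
  specialize (H x ltac:(eapply Rle_trans; [apply Rmax_r|exact Hx])).
  rewrite sum_n_SR in H.
  set (s := sum_n _ N) in *.
  replace (F x - s) with ((F x - (s + a (S (S N)) * npow (S (S N)) x))
                          + a (S (S N)) * npow (S (S N)) x) by ring.
  eapply Rle_trans; [apply Rabs_triang|].
  rewrite (Rabs_mult (a _)), (Rabs_pos_eq (npow _ _)) by (left; apply npow_pos).
  assert (H1 := npow_antitone (S (S N)) (S (S (S N))) x ltac:(lia) ltac:(lia) Hx0).
  assert (P := npow_pos (S (S (S N))) x); assert (HB := Rle_abs B).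
  assert (P' := Rabs_pos B). nra.
Qed.

(** Applied to the difference, which expands 0: if all earlier coefficients vanish, the next one
    would exceed the error term by [npow_gap] unless it vanishes too. Truncation supplies the
    induction. *)
Lemma expands_unique (N : nat) (F : R -> R) (a b : nat -> R) :
  expands N F a -> expands N F b -> forall k, (k <= N)%nat -> a (S k) = b (S k).
Proof.
  assert (Hd : forall M c, expands M (fun _ => 0) c ->
            (forall k, (k < M)%nat -> c (S k) = 0) -> c (S M) = 0).
  { intros M c [B [x0 H]] Hc.
    destruct (Req_dec (c (S M)) 0) as [|Hn]; [assumption|exfalso].
    destruct (npow_gap M B (Rabs (c (S M))) x0 (Rabs_pos_lt _ Hn)) as [x [Hx Hlt]].
    specialize (H x Hx); revert H.
    rewrite (sum_n_single _ M M); [|lia|intros k Hk Hne; rewrite Hc by lia; ring].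
    rewrite Rminus_0_l, Rabs_Ropp, Rabs_mult, (Rabs_pos_eq (npow _ _)) by (left; apply npow_pos).
    lra. }
  assert (Hz : forall M c, expands M (fun _ => 0) c -> forall k, (k <= M)%nat -> c (S k) = 0).
  { induction M as [|M IH]; intros c Hc k Hk.
    - replace k with 0%nat by lia; apply Hd; [exact Hc|lia].
    - assert (IH' := IH c (expands_trunc _ _ _ Hc)).
      destruct (Nat.eq_dec k (S M)) as [->|]; [|apply IH'; lia].
      apply Hd; [exact Hc|intros; apply IH'; lia]. }
  intros Ha Hb k Hk.
  assert (E := expands_minus _ _ _ _ _ Ha Hb).
  apply (expands_ext _ _ (fun _ => 0) _ (fun n => a n - b n) 0) in E;
    [|intros; ring|reflexivity].
  specialize (Hz _ _ E k Hk); cbv beta in Hz; lra.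
Qed.

Lemma expands_dirichlet_series (N : nat) (F : R -> R) (a : nat -> R) :
  (forall x, 1 < x -> is_series (fun k => a (S k) * npow (S k) x) (F x)) -> expands N F a.
Proof.
  intros H.
  assert (Hb : exists B, forall k, Rabs (a (S k) * npow (S k) 2) <= B).
  { assert (H2 := ex_series_lim_0 _ (ex_intro _ _ (H 2 ltac:(lra)))).
    assert (H3 : is_lim_seq (fun k => Rabs (a (S k) * npow (S k) 2)) (Finite (Rabs 0)))
      by exact (is_lim_seq_abs _ _ H2).
    apply is_lim_seq_Reals in H3.
    destruct (maj_by_pos _ (exist _ _ H3)) as [B [_ HB]].
    exists B; intros k; specialize (HB k); rewrite Rabs_Rabsolu in HB; exact HB. }
  destruct Hb as [B HB].
  assert (HB0 : 0 <= B) by (eapply Rle_trans; [apply Rabs_pos|apply (HB 0%nat)]).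
  (* The signs of [a] are unknown, so convergence at 2 is used only to bound the terms a_n n^(-2).
     Write n^(-x) = n^(-2) n^(-(x-4)) n^(-2): the first factor controls the coefficient, the second
     is at most (N+2)^(-(x-4)) for n >= N + 2, and the third makes the tail summable. *)
  exists (B * zetaR 2 / npow (S (S N)) 4), 4; intros x Hx.
  assert (Hterm : forall k, Rabs (a (S (S N + k)) * npow (S (S N + k)) x)
                     <= B * npow (S (S N)) (x - 4) * npow (S k) 2).
  { intros k.
    replace x with (2 + ((x - 4) + 2)) at 1 by ring.
    rewrite (npow_plus _ 2), <- Rmult_assoc, Rabs_mult, (Rabs_pos_eq (npow _ (_ + _)))
      by (left; apply npow_pos).
    rewrite (Rmult_assoc B).
    apply Rmult_le_compat; [apply Rabs_pos|left; apply npow_pos|apply HB|].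
    rewrite npow_plus.
    apply Rmult_le_compat; try (left; apply npow_pos); apply npow_antitone; lia || lra. }
  assert (Hser : ex_series (fun k => B * npow (S (S N)) (x - 4) * npow (S k) 2)).
  { apply (ex_series_scal (B * npow (S (S N)) (x - 4)) (fun k => npow (S k) 2)).
    apply zeta_ex_series; lra. }
  assert (HFx := H x ltac:(lra)).
  assert (E := is_series_unique _ _ HFx).
  rewrite (Series_incr_n _ (S N)) in E; [|lia|eexists; exact HFx].
  simpl pred in E; rewrite <- sum_n_Reals in E; rewrite <- E.
  set (s := sum_n _ N); match goal with |- Rabs (?s' + ?T - _) <= _ =>
    replace (s' + T - s) with T by (unfold s; lra) end.
  assert (Habs : ex_series (fun k => Rabs (a (S (S N + k)) * npow (S (S N + k)) x))).
  { apply (ex_series_le_R _ _ (fun k => conj (Rabs_pos _) (Hterm k)) Hser). }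
  eapply Rle_trans; [apply Series_Rabs, Habs|].
  eapply Rle_trans; [apply (Series_le _ _ (fun k => conj (Rabs_pos _) (Hterm k)) Hser)|].
  rewrite Series_scal_l; fold (zetaR 2).
  assert (E4 : npow (S (S N)) x = npow (S (S N)) (x - 4) * npow (S (S N)) 4)
    by (rewrite <- npow_plus; f_equal; ring).
  rewrite E4; right; field; apply Rgt_not_eq, npow_pos.
Qed.

Lemma expands_npow (N q : nat) : (1 <= q)%nat ->
  expands N (npow q) (fun n => if Nat.eqb n q then 1 else 0).
Proof.
  intros Hq; exists 1, 0; intros x Hx.
  assert (P := npow_pos (S (S N)) x).
  destruct (Nat.le_gt_cases q (S N)) as [Hl|Hl].
  - rewrite (sum_n_single _ N (q - 1)); [|lia|].
    + replace (S (q - 1)) with q by lia; rewrite Nat.eqb_refl.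
      rewrite Rmult_1_l, Rminus_diag, Rabs_R0; lra.
    + intros k Hk Hne; destruct (Nat.eqb_spec (S k) q); [lia|ring].
  - rewrite sum_n_zero; [|intros k Hk; destruct (Nat.eqb_spec (S k) q); [lia|ring]].
    rewrite Rminus_0_r, Rabs_pos_eq, Rmult_1_l by (left; apply npow_pos).
    apply npow_antitone; lia || lra.
Qed.


(** * Binomial expansions and Euler factors *)

Lemma Rpower_bound_near_1 (v g : R) : / 2 <= v <= 2 -> Rpower v g <= Rpower 2 (Rabs g).
Proof.
  intros Hv; unfold Rpower; apply exp_le_compat.
  assert (L2 : ln v <= ln 2) by (apply ln_le; lra).
  assert (L1 : - ln 2 <= ln v) by (rewrite <- ln_Rinv by lra; apply ln_le; lra).
  eapply Rle_trans; [apply Rle_abs|rewrite Rabs_mult].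
  apply Rmult_le_compat_l; [apply Rabs_pos|apply Rabs_le; lra].
Qed.

Lemma is_derive_Rpower_1_minus (b u : R) : u < 1 ->
  is_derive (fun t => Rpower (1 - t) (- b)) u (b * Rpower (1 - u) (- (b + 1))).
Proof.
  intros Hu.
  replace (b * Rpower (1 - u) (- (b + 1))) with (-1 * (- b * Rpower (1 - u) (- b - 1)))
    by (replace (- (b + 1)) with (- b - 1) by ring; ring).
  apply (is_derive_comp (fun v => Rpower v (- b)) (fun t => 1 - t)).
  - apply is_derive_Reals, derivable_pt_lim_power; lra.
  - auto_derive; [trivial|ring].
Qed.

(* The step integrates the expansion of the derivative [b (1 - u)^(-(b + 1))],
   so the coefficients stay nonnegative for [b >= 0]. *)
Lemma binomial_expansion (K : nat) : forall b : R, exists (c : nat -> R) (B : R),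
  0 <= B /\ c 0%nat = 1 /\ (0 <= b -> forall k, 0 <= c k) /\
  forall u, Rabs u <= / 2 ->
    Rabs (Rpower (1 - u) (- b) - sum_n (fun k => c k * u ^ k) K) <= B * Rabs u ^ S K.
Proof.
  induction K as [|K IH]; intros b.
  - exists (fun _ => 1), (Rabs b * Rpower 2 (Rabs (- (b + 1)))).
    split; [apply Rmult_le_pos; [apply Rabs_pos|left; apply exp_pos]|].
    split; [reflexivity|split; [intros; lra|intros u Hu]].
    rewrite sum_n_OR, !pow_O, Rmult_1_l, pow_1.
    destruct (MVT_cor4 (fun t => Rpower (1 - t) (- b))
      (fun t => b * Rpower (1 - t) (- (b + 1))) 0 (/ 2)) with (b := u) as [t [Ht Ht']].
    + intros t Ht; apply is_derive_Rpower_1_minus.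
      rewrite Rminus_0_r in Ht; apply Rabs_le_between in Ht; lra.
    + rewrite Rminus_0_r; exact Hu.
    + cbv beta in Ht; rewrite !Rminus_0_r in Ht; rewrite !Rminus_0_r in Ht'.
      assert (E1 : Rpower 1 (- b) = 1) by (unfold Rpower; rewrite ln_1, Rmult_0_r; apply exp_0).
      rewrite E1 in Ht; rewrite Ht, !Rabs_mult.
      apply Rmult_le_compat_r; [apply Rabs_pos|].
      apply Rmult_le_compat_l; [apply Rabs_pos|].
      rewrite Rabs_pos_eq by (left; apply exp_pos).
      assert (Hta : Rabs t <= / 2) by lra.
      apply Rabs_le_between in Hta; apply Rpower_bound_near_1; lra.
  - destruct (IH (b + 1)) as [c [B [HB0 [_ [Hc HB]]]]].
    set (c' := fun k => match k with O => 1 | S k => b * c k / INR (S k) end).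
    exists c', (Rabs b * B).
    split; [apply Rmult_le_pos; [apply Rabs_pos|exact HB0]|split; [reflexivity|split]].
    { intros Hb [|k]; simpl c'; [lra|].
      apply Rdiv_le_0_compat; [|apply INR_S_pos].
      apply Rmult_le_pos; [lra|apply Hc; lra]. }
    intros u Hu.
    set (g := fun t => Rpower (1 - t) (- b) - (1 + sum_n (fun k => c' (S k) * t ^ S k) K)).
    set (dg := fun t => b * Rpower (1 - t) (- (b + 1))
                        - (0 + sum_n (fun k => b * (c k * t ^ k)) K)).
    assert (Hg : forall t, t < 1 -> is_derive g t (dg t)).
    { intros t Ht; unfold g, dg.
      apply (is_derive_minus (fun t => Rpower (1 - t) (- b))).
      - apply is_derive_Rpower_1_minus, Ht.
      - apply (is_derive_plus (fun _ => 1)); [apply is_derive_Reals, derivable_pt_lim_const|].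
        apply (is_derive_sum_n (fun k t => c' (S k) * t ^ S k)); intros k _.
        auto_derive; [trivial|].
        change (match k with O => 1 | S _ => INR k + 1 end) with (INR (S k)).
        unfold c'; simpl pred; field; apply Rgt_not_eq, INR_S_pos. }
    assert (Esum : forall t, sum_n (fun k => c' k * t ^ k) (S K)
                    = 1 + sum_n (fun k => c' (S k) * t ^ S k) K :> R).
    { intros t; unfold sum_n at 1; rewrite sum_Sn_m by lia.
      rewrite <- (sum_n_m_S (fun k => c' k * t ^ k)).
      change (c' 0%nat * t ^ 0 + sum_n (fun k => c' (S k) * t ^ S k) K
              = 1 + sum_n (fun k => c' (S k) * t ^ S k) K).
      simpl; ring. }
    rewrite Esum; change (Rabs (g u) <= Rabs b * B * Rabs u ^ S (S K)).
    assert (Hg0 : g 0 = 0).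
    { unfold g; rewrite sum_n_zero by (intros; simpl; ring).
      rewrite Rminus_0_r; unfold Rpower; rewrite ln_1, Rmult_0_r, exp_0; ring. }
    destruct (MVT_cor4 g dg 0 (/ 2)) with (b := u) as [t [Ht Ht']].
    + intros t Ht; apply Hg.
      rewrite Rminus_0_r in Ht; apply Rabs_le_between in Ht; lra.
    + rewrite Rminus_0_r; exact Hu.
    + rewrite Hg0, !Rminus_0_r in Ht; rewrite !Rminus_0_r in Ht'; rewrite Ht.
      assert (Ed : dg t = b * (Rpower (1 - t) (- (b + 1)) - sum_n (fun k => c k * t ^ k) K))
        by (unfold dg; rewrite sum_n_scalR; ring).
      rewrite Ed, !Rabs_mult.
      specialize (HB t ltac:(lra)).
      assert (Hpow : Rabs t ^ S K <= Rabs u ^ S K)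
        by (apply pow_incr; split; [apply Rabs_pos|exact Ht']).
      assert (Rabs (Rpower (1 - t) (- (b + 1)) - sum_n (fun k => c k * t ^ k) K)
              <= B * Rabs u ^ S K).
      { eapply Rle_trans; [exact HB|]; apply Rmult_le_compat_l; assumption. }
      replace (Rabs b * B * Rabs u ^ S (S K)) with (Rabs b * (B * Rabs u ^ S K) * Rabs u)
        by (simpl; ring).
      apply Rmult_le_compat_r; [apply Rabs_pos|].
      apply Rmult_le_compat_l; [apply Rabs_pos|assumption].
Qed.

Lemma expands_one (N : nat) :
  expands N (fun _ => 1) (fun n => if Nat.eqb n 1 then 1 else 0).
Proof.
  apply (expands_ext N (npow 1) _ (fun n => if Nat.eqb n 1 then 1 else 0) _ 0);
    [intros; apply npow_1|reflexivity|apply expands_npow; lia].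
Qed.

(** Multiplication by q^(-x) moves the coefficient at n / q to n; this is how a sieve step acts on
    coefficients. *)
Lemma conv_delta_r (N q n : nat) (a : nat -> R) : (1 <= q)%nat -> (1 <= n <= S N)%nat ->
  conv N a (fun j => if Nat.eqb j q then 1 else 0) n
  = if Nat.eqb (n mod q) 0 then a (n / q)%nat else 0.
Proof.
  intros Hq Hn; unfold conv.
  destruct (Nat.eqb_spec (n mod q) 0) as [Hm|Hm].
  - assert (E : n = (q * (n / q))%nat) by (apply Nat.Div0.div_exact; exact Hm).
    set (m := (n / q)%nat) in *.
    assert (Hm0 : (1 <= m)%nat) by (destruct m; lia).
    assert (Hqn : (q <= n)%nat) by nia.
    assert (Hmn : (m <= n)%nat) by nia.
    rewrite (sum_n_single _ N (m - 1)); [|lia|].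
    + rewrite (sum_n_single _ N (q - 1)); [|lia|].
      * replace (S (m - 1)) with m by lia; replace (S (q - 1)) with q by lia.
        replace (Nat.eqb (m * q) n) with true by (symmetry; apply Nat.eqb_eq; lia).
        rewrite Nat.eqb_refl; ring.
      * intros j Hj Hne; destruct (Nat.eqb_spec (S j) q); [lia|].
        destruct (Nat.eqb _ n); ring.
    + intros i Hi Hne; apply sum_n_zero; intros j Hj.
      destruct (Nat.eqb_spec (S i * S j) n); [|ring].
      destruct (Nat.eqb_spec (S j) q); [|ring].
      exfalso; apply Hne; assert (S i = m) by nia; lia.
  - apply sum_n_zero; intros i Hi; apply sum_n_zero; intros j Hj.
    destruct (Nat.eqb_spec (S i * S j) n) as [E|]; [|ring].
    destruct (Nat.eqb_spec (S j) q) as [E'|]; [|ring].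
    exfalso; apply Hm; rewrite <- E, <- E'; apply Nat.Div0.mod_mul.
Qed.

Lemma conv_nonneg (N n : nat) (a b : nat -> R) :
  (forall k, 0 <= a k) -> (forall k, 0 <= b k) -> 0 <= conv N a b n.
Proof.
  intros Ha Hb; apply sum_n_nonneg; intros i _; apply sum_n_nonneg; intros j _.
  destruct (Nat.eqb _ n); [apply Rmult_le_pos; auto|lra].
Qed.

Lemma conv_1 (N : nat) (a b : nat -> R) : conv N a b 1 = a 1%nat * b 1%nat.
Proof.
  unfold conv; rewrite (sum_n_single _ N 0); [|lia|].
  - rewrite (sum_n_single _ N 0); [reflexivity|lia|].
    intros j Hj Hne; destruct (Nat.eqb_spec (1 * S j) 1); [lia|reflexivity].
  - intros i Hi Hne; apply sum_n_zero; intros j Hj.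
    destruct (Nat.eqb_spec (S i * S j) 1); [nia|reflexivity].
Qed.

Lemma conv_ge (N n : nat) (a b : nat -> R) : (1 <= n <= S N)%nat ->
  (forall k, 0 <= a k) -> (forall k, 0 <= b k) -> a n * b 1%nat <= conv N a b n.
Proof.
  intros Hn Ha Hb; unfold conv.
  assert (Hp : forall i j, 0 <= if Nat.eqb (S i * S j) n then a (S i) * b (S j) else 0)
    by (intros; destruct (Nat.eqb _ n); [apply Rmult_le_pos; auto|lra]).
  eapply Rle_trans; [|apply (sum_n_term_le _ N (n - 1));
    [intros; apply sum_n_nonneg; intros; apply Hp|lia]].
  eapply Rle_trans; [|apply (sum_n_term_le _ N 0); [intros; apply Hp|lia]].
  replace (S (n - 1)) with n by lia; rewrite Nat.mul_1_r, Nat.eqb_refl; lra.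
Qed.

Lemma npow_eventually_small (q : nat) (x : R) : (2 <= q)%nat -> 1 <= x ->
  Rabs (npow q x) <= / 2.
Proof.
  intros Hq Hx; rewrite Rabs_pos_eq by (left; apply npow_pos).
  apply Rle_trans with (npow 2 x); [apply npow_antitone; lia || lra|].
  replace x with (1 + (x - 1)) by ring; rewrite npow_plus.
  rewrite npow_one by lia.
  assert (H := npow_le_1 2 (x - 1) ltac:(lia) ltac:(lra)).
  replace (INR 2) with 2 by (simpl; ring); lra.
Qed.

(** Put u = q^(-x) in [binomial_expansion]: u^k is (q^k)^(-x), so the coefficients sit on powers of
    q and inherit their sign. The remainder u^(N+1) is at most (N+2)^(-x) because q^(N+1) >= 2^(N+1)
    >= N + 2. *)
Lemma expands_euler_factor (N q : nat) (b : R) : 0 <= b -> (2 <= q)%nat ->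
  exists g : nat -> R, (forall n, 0 <= g n) /\ g 1%nat = 1 /\
    expands N (fun x => Rpower (1 - npow q x) (- b)) g.
Proof.
  intros Hb Hq.
  destruct (binomial_expansion N b) as [c [B [HB0 [Hc0 [Hc HB]]]]]; specialize (Hc Hb).
  set (g n := sum_n (fun k => if Nat.eqb n (q ^ k) then c k else 0) N).
  assert (Hqpos : forall k, (1 <= q ^ k)%nat)
    by (intros k; apply Nat.neq_0_lt_0, Nat.pow_nonzero; lia).
  exists g; split; [|split].
  - intros n; apply sum_n_nonneg; intros k _; destruct (Nat.eqb _ _); [apply Hc|lra].
  - unfold g; rewrite (sum_n_single _ N 0); [exact Hc0|lia|].
    intros k Hk Hne; destruct (Nat.eqb_spec 1 (q ^ k)) as [E|]; [|reflexivity].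
    exfalso; destruct k as [|k]; [lia|]; simpl in E; specialize (Hqpos k); nia.
  - assert (Hsum : forall M, exists B' x0, forall x, x0 <= x ->
       Rabs (sum_n (fun k => c k * npow q x ^ k) M
        - sum_n (fun n => sum_n (fun k => if Nat.eqb (S n) (q ^ k) then c k else 0) M
                          * npow (S n) x) N) <= B' * npow (S (S N)) x).
    { assert (Hone : forall k, exists B' x0, forall x, x0 <= x ->
        Rabs (c k * npow q x ^ k
          - sum_n (fun n => (if Nat.eqb (S n) (q ^ k) then c k else 0) * npow (S n) x) N)
          <= B' * npow (S (S N)) x).
      { intros k; destruct (expands_npow N (q ^ k) (Hqpos k)) as [B' [x0 H]].
        exists (c k * B'), x0; intros x Hx.
        rewrite <- npow_pow by lia.
        rewrite (sum_n_extR _ (fun n => c k * ((if Nat.eqb (S n) (q ^ k) then 1 else 0)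
          * npow (S n) x))) by (intros; destruct (Nat.eqb _ _); ring).
        rewrite sum_n_scalR, <- Rmult_minus_distr_l, Rabs_mult, Rabs_pos_eq by apply Hc.
        rewrite Rmult_assoc; apply Rmult_le_compat_l; [apply Hc|apply H, Hx]. }
      induction M as [|M [B1 [x1 H1]]].
      - destruct (Hone 0%nat) as [B' [x0 H]]; exists B', x0; intros x Hx.
        rewrite sum_n_OR, (sum_n_extR _ (fun n =>
          (if Nat.eqb (S n) (q ^ 0) then c 0%nat else 0) * npow (S n) x));
          [apply H, Hx|intros; rewrite sum_n_OR; reflexivity].
      - destruct (Hone (S M)) as [B2 [x2 H2]].
        exists (B1 + B2), (Rmax x1 x2); intros x Hx.
        specialize (H1 x ltac:(eapply Rle_trans; [apply Rmax_l|exact Hx])).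
        specialize (H2 x ltac:(eapply Rle_trans; [apply Rmax_r|exact Hx])).
        rewrite sum_n_SR.
        rewrite (sum_n_extR _ (fun n =>
          sum_n (fun k => if Nat.eqb (S n) (q ^ k) then c k else 0) M * npow (S n) x
          + (if Nat.eqb (S n) (q ^ S M) then c (S M) else 0) * npow (S n) x) N)
          by (intros k; rewrite sum_n_SR; apply Rmult_plus_distr_r).
        rewrite sum_n_plusR.
        match goal with |- Rabs (?a + ?b - (?c + ?d)) <= _ =>
          replace (a + b - (c + d)) with ((a - c) + (b - d)) by ring end.
        eapply Rle_trans; [apply Rabs_triang|]; lra. }
    destruct (Hsum N) as [B' [x0 H]].
    exists (B + B'), (Rmax 1 x0); intros x Hx.
    assert (Hx1 : 1 <= x) by (eapply Rle_trans; [apply Rmax_l|exact Hx]).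
    specialize (H x ltac:(eapply Rle_trans; [apply Rmax_r|exact Hx])).
    specialize (HB (npow q x) (npow_eventually_small q x Hq Hx1)).
    assert (Hpow : Rabs (npow q x) ^ S N <= npow (S (S N)) x).
    { rewrite Rabs_pos_eq, <- npow_pow by (lia || (left; apply npow_pos)).
      apply npow_antitone; [lia| |lra].
      apply Nat.le_trans with (2 ^ S N)%nat; [apply Nat.pow_gt_lin_r; lia|].
      apply Nat.pow_le_mono_l; lia. }
    apply (Rmult_le_compat_l B) in Hpow; [|exact HB0].
    set (s := sum_n (fun k => c k * npow q x ^ k) N) in *.
    match type of H with Rabs (_ - ?tt) <= _ =>
      change (Rabs (Rpower (1 - npow q x) (- b) - tt) <= (B + B') * npow (S (S N)) x);
      set (t := tt) in * end.
    replace (Rpower (1 - npow q x) (- b) - t)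
      with ((Rpower (1 - npow q x) (- b) - s) + (s - t)) by ring.
    eapply Rle_trans; [apply Rabs_triang|]; lra.
Qed.

(** Near 1 the map v -> v^b changes by at most a constant times |v - 1|, which is the binomial
    expansion of order 0; an error of order (N+2)^(-x) in Z therefore stays of that order. *)
Lemma expands_Rpower_one (N : nat) (Z : R -> R) (b : R) :
  expands N Z (fun n => if Nat.eqb n 1 then 1 else 0) ->
  expands N (fun x => Rpower (Z x) b) (fun n => if Nat.eqb n 1 then 1 else 0).
Proof.
  intros [B [x0 H]].
  assert (E : forall x, sum_n (fun k => (if Nat.eqb (S k) 1 then 1 else 0) * npow (S k) x) N = 1).
  { intros x; rewrite (sum_n_single _ N 0); [rewrite npow_1; simpl; ring|lia|].
    intros k Hk Hne; destruct (Nat.eqb_spec (S k) 1); [lia|ring]. }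
  destruct (binomial_expansion 0 (- b)) as [c [B' [HB0 [Hc0 [_ HB]]]]].
  (* From x1 on, 2 |B| 2^(-x) < 1, which puts Z x within 1/2 of 1, the range of
     [binomial_expansion]. *)
  destruct (npow_gap 0 (2 * Rabs B) 1 (Rmax 0 x0) ltac:(lra)) as [x1 [Hx1 Hlt]].
  exists (B' * B), x1; intros x Hx.
  assert (Hx10 : 0 <= x1) by (eapply Rle_trans; [apply Rmax_l|exact Hx1]).
  assert (Hx1' : x0 <= x1) by (eapply Rle_trans; [apply Rmax_r|exact Hx1]).
  specialize (H x ltac:(lra)); rewrite E in H |- *.
  assert (Hs : Rabs (1 - Z x) <= / 2).
  { rewrite Rabs_minus_sym; eapply Rle_trans; [exact H|].
    rewrite npow_1, Rmult_1_r in Hlt.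
    assert (H1 := npow_antitone 2 (S (S N)) x ltac:(lia) ltac:(lia) ltac:(lra)).
    assert (H2 : npow 2 x <= npow 2 x1).
    { unfold npow; apply exp_le_compat.
      assert (0 <= ln (INR 2)) by (rewrite <- ln_1; apply ln_le; simpl; lra); nra. }
    assert (P := npow_pos (S (S N)) x); assert (P1 := Rle_abs B); assert (P2 := Rabs_pos B).
    nra. }
  specialize (HB (1 - Z x) Hs).
  rewrite sum_n_OR, Hc0, pow_O, pow_1, Ropp_involutive, Rmult_1_r in HB.
  replace (1 - (1 - Z x)) with (Z x) in HB by ring.
  eapply Rle_trans; [exact HB|].
  rewrite Rmult_assoc, Rabs_minus_sym; apply Rmult_le_compat_l; [exact HB0|exact H].
Qed.

(** * Sieving zeta *)

(** For n >= 1: all prime factors of n exceed m. Excluding every divisor in 2..m lets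
    [sieved m (S m)] express, for m >= 1, that [S m] is prime. *)
Definition sieved (m n : nat) : Prop := forall i, (2 <= i <= m)%nat -> ~ Nat.divide i n.

Definition indic (P : Prop) : R := if excluded_middle_informative P then 1 else 0.

Lemma indic_true (P : Prop) : P -> indic P = 1.
Proof. intros H; unfold indic; destruct (excluded_middle_informative P); tauto. Qed.

Lemma indic_false (P : Prop) : ~ P -> indic P = 0.
Proof. intros H; unfold indic; destruct (excluded_middle_informative P); tauto. Qed.

Lemma indic_iff (P Q : Prop) : (P <-> Q) -> indic P = indic Q.
Proof.
  intros H; destruct (classic P) as [HP|HP].
  - rewrite !indic_true; tauto.
  - rewrite !indic_false; tauto.
Qed.

Lemma sieved_S_composite (m n i : nat) : (2 <= i <= m)%nat -> Nat.divide i (S m) ->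
  sieved (S m) n <-> sieved m n.
Proof.
  intros Hi Hd; split; intros H j Hj Hjn.
  - apply (H j); [lia|exact Hjn].
  - destruct (Nat.eq_dec j (S m)) as [->|]; [|apply (H j); [lia|exact Hjn]].
    apply (H i Hi), (Nat.divide_trans _ (S m)); assumption.
Qed.

(** [S m] is prime, so each i in 2..m is coprime to it and Gauss's lemma cancels the factor. *)
Lemma sieved_mul (m k : nat) : (1 <= m)%nat -> sieved m (S m) ->
  sieved m (S m * k) <-> sieved m k.
Proof.
  intros Hm Hq; split; intros H i Hi Hd.
  - apply (H i Hi), Nat.divide_mul_r, Hd.
  - apply (H i Hi), (Nat.gauss i (S m)); [exact Hd|].
    set (g := Nat.gcd i (S m)).
    assert (Hg1 : Nat.divide g i) by apply Nat.gcd_divide_l.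
    assert (Hg2 : Nat.divide g (S m)) by apply Nat.gcd_divide_r.
    assert (Hgi : (g <= i)%nat) by (apply Nat.divide_pos_le; [lia|exact Hg1]).
    destruct (Nat.eq_dec g 0) as [E|]; [rewrite E in Hg1; apply Nat.divide_0_l in Hg1; lia|].
    destruct (Nat.eq_dec g 1); [assumption|exfalso].
    apply (Hq g); [lia|exact Hg2].
Qed.

(** The coefficients of Z (1 - q^(-x)) for the prime q = m + 1: at multiples of q the two terms
    cancel, elsewhere only the first is present. *)
Lemma indic_sieve_step (m n : nat) : (1 <= m)%nat -> sieved m (S m) ->
  indic (sieved m n) - (if Nat.eqb (n mod S m) 0 then indic (sieved m (n / S m)) else 0)
  = indic (sieved (S m) n).
Proof.
  intros Hm Hq; destruct (Nat.eqb_spec (n mod S m) 0) as [E|E].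
  - apply Nat.Div0.div_exact in E.
    rewrite (indic_false (sieved (S m) n)).
    + rewrite E at 1; rewrite (indic_iff _ _ (sieved_mul m (n / S m) Hm Hq)); ring.
    + intros H; apply (H (S m)); [lia|].
      rewrite E; apply Nat.divide_factor_l.
  - rewrite Rminus_0_r; apply indic_iff; split; intros H j Hj Hjn.
    + destruct (Nat.eq_dec j (S m)) as [->|]; [|apply (H j); [lia|exact Hjn]].
      apply E, Nat.Lcm0.mod_divide, Hjn.
    + apply (H j); [lia|exact Hjn].
Qed.

(** Z is zeta with the Euler factors up to m removed, E the product of those factors to the power b.
    When [S m] is prime, Z is multiplied by 1 - q^(-x) and E by (1 - q^(-x))^(-b); when it is
    composite, nothing changes. The factorization of zeta^b is exact throughout; only the expansions
    carry errors. *)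
Lemma sieve_zeta (N : nat) (b : R) : 0 <= b -> forall m, (1 <= m)%nat ->
  exists (Z E : R -> R) (e : nat -> R),
    (forall x, 2 <= x -> 0 < Z x /\ Rpower (zetaR x) b = Rpower (Z x) b * E x) /\
    expands N Z (fun n => indic (sieved m n)) /\
    (forall n, 0 <= e n) /\ e 1%nat = 1 /\ expands N E e.
Proof.
  intros Hb; induction 1 as [|m Hm (Z & E & e & HZ & HZe & He & He1 & HEe)].
  - exists zetaR, (fun _ => 1), (fun n => if Nat.eqb n 1 then 1 else 0).
    split; [|split; [|split; [|split]]].
    + intros x Hx; split; [|ring].
      assert (H := zetaR_ge_1 x ltac:(lra)); lra.
    + apply expands_dirichlet_series; intros x Hx.
      apply (is_series_ext (fun k => npow (S k) x)).
      * intros k; rewrite indic_true; [symmetry; apply Rmult_1_l|intros i Hi; lia].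
      * apply Series_correct, zeta_ex_series, Hx.
    + intros n; destruct (Nat.eqb n 1); lra.
    + reflexivity.
    + apply expands_one.
  - destruct (classic (sieved m (S m))) as [Hq|Hq].
    + destruct (expands_euler_factor N (S m) b Hb ltac:(lia)) as (g & Hg & Hg1 & Hge).
      exists (fun x => Z x - Z x * npow (S m) x),
        (fun x => E x * Rpower (1 - npow (S m) x) (- b)), (conv N e g).
      split; [|split; [|split; [|split]]].
      * intros x Hx; destruct (HZ x Hx) as [HZ0 HZ1].
        assert (H := npow_eventually_small (S m) x ltac:(lia) ltac:(lra)).
        apply Rabs_le_between in H.
        replace (Z x - Z x * npow (S m) x) with (Z x * (1 - npow (S m) x)) by ring.
        split; [nra|].
        rewrite HZ1, <- Rpower_mult_distr by lra.
        assert (H1 : Rpower (1 - npow (S m) x) b * Rpower (1 - npow (S m) x) (- b) = 1)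
          by (rewrite <- Rpower_plus, Rplus_opp_r; apply Rpower_O; lra).
        transitivity (Rpower (Z x) b * E x
          * (Rpower (1 - npow (S m) x) b * Rpower (1 - npow (S m) x) (- b)));
          [rewrite H1; ring|ring].
      * assert (H := expands_minus _ _ _ _ _ HZe
          (expands_mult _ _ _ _ _ HZe (expands_npow N (S m) ltac:(lia)))).
        revert H; apply (expands_ext N _ _ _ _ 0); [reflexivity|].
        intros n Hn; cbv beta; rewrite conv_delta_r by lia.
        apply indic_sieve_step; assumption.
      * intros n; apply conv_nonneg; assumption.
      * rewrite conv_1, He1, Hg1; ring.
      * apply expands_mult; assumption.
    + exists Z, E, e; split; [exact HZ|split; [|split; [|split]]]; try assumption.
      apply not_all_ex_not in Hq; destruct Hq as [i Hi].
      apply imply_to_and in Hi; destruct Hi as [Hi Hd]; apply NNPP in Hd.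
      revert HZe; apply (expands_ext N _ _ _ _ 0); [reflexivity|].
      intros n _; apply indic_iff; symmetry; apply (sieved_S_composite m n i Hi Hd).
Qed.

(** Sieving up to N + 1 removes every n in 2..N+1, since n divides itself. Hence Z, and with it Z^b,
    expands as 1, and all coefficients come from the Euler factors. *)
Lemma zeta_Rpower_expands (N : nat) (b : R) : 0 <= b ->
  exists e : nat -> R, (forall n, 0 <= e n) /\ e 1%nat = 1 /\
    expands N (fun x => Rpower (zetaR x) b) e.
Proof.
  intros Hb; destruct (sieve_zeta N b Hb (S N) ltac:(lia))
    as (Z & E & e & HZ & HZe & He & He1 & HEe).
  set (del := fun n => if Nat.eqb n 1 then 1 else 0).
  exists (conv N del e); split; [|split].
  - intros n; apply conv_nonneg; [intros k; unfold del; destruct (Nat.eqb k 1); lra|exact He].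
  - rewrite conv_1, He1; unfold del; simpl; ring.
  - assert (HZ' : expands N Z del).
    { revert HZe; apply (expands_ext N _ _ _ _ 0); [reflexivity|].
      intros n Hn; unfold del; destruct (Nat.eqb_spec n 1) as [->|Hn1].
      - apply indic_true; intros i Hi Hd; apply Nat.divide_1_r in Hd; lia.
      - apply indic_false; intros H; apply (H n); [lia|apply Nat.divide_refl]. }
    generalize (expands_mult _ _ _ _ _ (expands_Rpower_one N Z b HZ') HEe).
    apply (expands_ext N _ _ _ _ 2); [|reflexivity].
    intros x Hx; symmetry; apply HZ, Hx.
Qed.

Theorem zeta_pow_coeff_ge_1 (alpha : R) (d : nat -> R) : 1 < alpha ->
  (forall x, 1 < x ->
     is_series (fun k => d (S k) * npow (S k) x) (Rpower (zetaR x) alpha)) ->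
  forall n, (1 <= n)%nat -> 1 <= d n.
Proof.
  intros Ha Hd n Hn.
  destruct (zeta_Rpower_expands n (alpha - 1) ltac:(lra)) as (e & He & He1 & Hee).
  assert (H1 : expands n zetaR (fun _ => 1)).
  { apply expands_dirichlet_series; intros x Hx.
    apply (is_series_ext (fun k => npow (S k) x)); [intros; symmetry; apply Rmult_1_l|].
    apply Series_correct, zeta_ex_series, Hx. }
  assert (H2 := expands_mult _ _ _ _ _ H1 Hee).
  apply (expands_ext _ _ (fun x => Rpower (zetaR x) alpha) _ (conv n (fun _ => 1) e) 2) in H2;
    [|intros x Hx|reflexivity].
  2:{ assert (Hz := zetaR_ge_1 x ltac:(lra)).
      rewrite <- (Rpower_1 (zetaR x)) at 1 by lra.
      rewrite <- Rpower_plus; f_equal; ring. }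
  assert (E := expands_unique _ _ _ _ (expands_dirichlet_series n _ _ Hd) H2 (n - 1) ltac:(lia)).
  replace (S (n - 1)) with n in E by lia; rewrite E.
  (* In the convolution of 1 with [e], keeping only the pair (n, 1) already gives [e 1 = 1]. *)
  assert (Hc := conv_ge n n (fun _ => 1) e ltac:(lia) ltac:(intros; lra) He).
  rewrite He1 in Hc; lra.
Qed.


(** * From the complex definition to the real axis *)

Lemma Cnpow_real (n : nat) (x : R) : Cnpow n (- RtoC x)%C = RtoC (npow n x).
Proof.
  unfold Cnpow, Cexp, npow, RtoC; simpl.
  replace (- x * 0 + - 0 * ln (INR n)) with 0 by ring.
  rewrite cos_0, sin_0; f_equal; [|ring].
  rewrite Rmult_1_r; f_equal; ring.
Qed.

Lemma zeta_real (x : R) : zeta (RtoC x) = RtoC (zetaR x).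
Proof.
  unfold zeta, CSeries, zetaR; unfold RtoC at 3; f_equal.
  - apply Series_ext; intros k; rewrite Cnpow_real; reflexivity.
  - rewrite (Series_ext _ (fun _ => 0)) by (intros k; rewrite Cnpow_real; reflexivity).
    assert (H := is_series_finite (fun _ => 0) 0 (fun _ _ => eq_refl)).
    rewrite sum_n_OR in H; apply is_series_unique, H.
Qed.

Lemma sum_n_Re (u : nat -> C) (n : nat) : Re (sum_n u n) = sum_n (fun k => Re (u k)) n :> R.
Proof.
  induction n as [|n IH].
  - rewrite sum_O, sum_n_OR; reflexivity.
  - rewrite sum_Sn, sum_n_SR, <- IH; reflexivity.
Qed.

Lemma sum_n_Im (u : nat -> C) (n : nat) : Im (sum_n u n) = sum_n (fun k => Im (u k)) n :> R.
Proof.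
  induction n as [|n IH].
  - rewrite sum_O, sum_n_OR; reflexivity.
  - rewrite sum_Sn, sum_n_SR, <- IH; reflexivity.
Qed.

Lemma is_series_C_iff (u : nat -> C) (l : C) :
  is_series u l <->
  is_series (fun k => Re (u k)) (Re l) /\ is_series (fun k => Im (u k)) (Im l).
Proof.
  split.
  - intros H; split; apply (is_lim_seq_spec _ (Finite _)); intros eps;
    destruct (proj1 (filterlim_locally _ _) H eps) as [N HN]; exists N; intros n Hn;
    destruct (HN n Hn) as [H1 H2].
    + rewrite <- sum_n_Re; exact H1.
    + rewrite <- sum_n_Im; exact H2.
  - intros [H1 H2]; apply filterlim_locally; intros eps.
    destruct (proj1 (filterlim_locally _ _) H1 eps) as [N1 HN1].
    destruct (proj1 (filterlim_locally _ _) H2 eps) as [N2 HN2].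
    exists (max N1 N2); intros n Hn; split.
    + generalize (HN1 n ltac:(lia)); rewrite <- sum_n_Re; exact (fun h => h).
    + generalize (HN2 n ltac:(lia)); rewrite <- sum_n_Im; exact (fun h => h).
Qed.

(** At real x the imaginary part of L vanishes, so exp (Re L) = zeta forces L = ln zeta, and the
    complex power becomes [Rpower]. From here on d enters only through this real identity. *)
Lemma zeta_pow_coeffs_real (alpha : R) (d : nat -> R) : zeta_pow_coeffs alpha d ->
  forall x, 1 < x ->
    is_series (fun k => d (S k) * npow (S k) x) (Rpower (zetaR x) alpha).
Proof.
  intros (L & _ & HL & Him & Hs) x Hx.
  specialize (HL (RtoC x) Hx); specialize (Him x Hx); specialize (Hs (RtoC x) Hx).
  rewrite zeta_real in HL.
  apply (f_equal Re) in HL.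
  unfold Cexp in HL; rewrite Him, cos_0 in HL; simpl in HL; rewrite Rmult_1_r in HL.
  apply is_series_C_iff in Hs; destruct Hs as [Hs _].
  replace (Rpower (zetaR x) alpha) with (Re (Cexp (RtoC alpha * L (RtoC x))%C)).
  - revert Hs; apply is_series_ext; intros k; rewrite Cnpow_real; simpl; ring.
  - unfold Rpower; rewrite <- HL, ln_exp; unfold Cexp; simpl.
    fold (Re (L (RtoC x))) (Im (L (RtoC x))); unfold Re, Im in *; rewrite Him.
    replace (alpha * 0 + 0 * fst (L (RtoC x))) with 0 by ring.
    rewrite cos_0, Rmult_1_r; f_equal; ring.
Qed.

(** * Growth of the weighted coefficient sums *)

Section Growth.

Variables (alpha : R) (d : nat -> R).
Hypothesis alpha_gt_1 : 1 < alpha.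
Hypothesis d_series : forall x, 1 < x ->
  is_series (fun k => d (S k) * npow (S k) x) (Rpower (zetaR x) alpha).

Let d_ge_1 : forall n, (1 <= n)%nat -> 1 <= d n := zeta_pow_coeff_ge_1 alpha d alpha_gt_1 d_series.

(** Clamping at 2 keeps the logarithm at least ln 2 > 0, so that negative powers of it are
    meaningful and monotone at n = 1 as well. *)
Definition lnmax2 (n : nat) : R := ln (INR (max n 2)).

Lemma ln2_pos : 0 < ln 2.
Proof. rewrite <- ln_1; apply ln_increasing; lra. Qed.

Lemma lnmax2_ge (n : nat) : ln 2 <= lnmax2 n.
Proof.
  apply ln_le; [lra|]; replace 2 with (INR 2) by (simpl; ring); apply le_INR; lia.
Qed.

Lemma Rpower_le_compat_l (x y a : R) : 0 <= a -> 0 < x -> x <= y -> Rpower x a <= Rpower y a.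
Proof.
  intros Ha Hx Hxy; unfold Rpower; apply exp_le_compat, Rmult_le_compat_l; [exact Ha|].
  apply ln_le; assumption.
Qed.

(* Rankin's trick with exponent [1 + 1 / ln n]. *)
Lemma coeff_sum_upper (n : nat) : (1 <= n)%nat ->
  sum_n (fun k => d (S k) / INR (S k)) (n - 1)
    <= exp 1 * Rpower (1 + / ln 2) alpha * Rpower (lnmax2 n) alpha.
Proof.
  intros Hn.
  assert (HL := lnmax2_ge n); assert (H2 := ln2_pos).
  set (s := / lnmax2 n).
  assert (Hs : 0 < s) by (apply Rinv_0_lt_compat; lra).
  assert (Hser := d_series (1 + s) ltac:(lra)).
  apply Rle_trans with (exp 1 * sum_n (fun k => d (S k) * npow (S k) (1 + s)) (n - 1)).
  - rewrite <- sum_n_scalR; apply sum_n_le_loc; intros k Hk.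
    assert (Hd := d_ge_1 (S k) ltac:(lia)).
    rewrite npow_plus, npow_one by lia.
    assert (He : 1 <= exp 1 * npow (S k) s).
    { unfold npow; rewrite <- exp_plus; rewrite <- exp_0 at 1; apply exp_le_compat.
      assert (Hl : ln (INR (S k)) <= lnmax2 n)
        by (apply ln_le; [apply INR_S_pos|apply le_INR; lia]).
      assert (s * ln (INR (S k)) <= s * lnmax2 n) by (apply Rmult_le_compat_l; lra).
      unfold s in H at 2; rewrite Rinv_l in H by lra; lra. }
    assert (Hi : 0 < / INR (S k)) by (apply Rinv_0_lt_compat, INR_S_pos).
    unfold Rdiv.
    replace (exp 1 * (d (S k) * (/ INR (S k) * npow (S k) s)))
      with (d (S k) * / INR (S k) * (exp 1 * npow (S k) s)) by ring.
    assert (0 < d (S k) * / INR (S k)) by (apply Rmult_lt_0_compat; lra).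
    nra.
  - rewrite Rmult_assoc; apply Rmult_le_compat_l; [left; apply exp_pos|].
    apply Rle_trans with (Rpower (zetaR (1 + s)) alpha).
    + rewrite <- (is_series_unique _ _ Hser).
      apply sum_n_le_Series; [|eexists; exact Hser].
      intros k; apply Rmult_le_pos; [|left; apply npow_pos].
      assert (Hd := d_ge_1 (S k) ltac:(lia)); lra.
    + assert (Hi : 0 < / ln 2) by (apply Rinv_0_lt_compat; lra).
      rewrite Rpower_mult_distr by lra.
      assert (Hz := zetaR_ge_1 (1 + s) ltac:(lra)).
      apply Rpower_le_compat_l; [lra|lra|].
      eapply Rle_trans; [apply zetaR_le, Hs|].
      (* As [lnmax2 n >= ln 2], the bound 1 + 1/s = 1 + [lnmax2 n] is at most (1 + 1/ln 2)
         [lnmax2 n]. *)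
      unfold s; rewrite Rinv_inv, Rmult_plus_distr_r, Rmult_1_l.
      assert (/ ln 2 * ln 2 <= / ln 2 * lnmax2 n) by (apply Rmult_le_compat_l; lra).
      rewrite Rinv_l in H by lra; lra.
Qed.

(* Rankin's trick in both directions: at exponent [1 + kappa / ln n] the tail
   beyond [n] is at most [exp (- kappa / 2)] times the full sum at
   [1 + kappa / (2 ln n)]. *)
Lemma coeff_sum_lower : exists c : R, 0 < c /\ exists n0 : nat, forall n, (n0 <= n)%nat ->
  c * Rpower (ln (INR n)) alpha <= sum_n (fun k => d (S k) / INR (S k)) (n - 1).
Proof.
  (* Chosen so that exp (-ka/2) 3^alpha = 1/2. The 3 comes from zeta (1 + s/2) <= 1 + 2/s <= 3/s for
     s <= 1, and the tail is then at most half of the lower bound s^(-alpha) for the full sum. *)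
  set (ka := 2 * (ln 2 + alpha * ln 3)).
  assert (H2 := ln2_pos).
  assert (H3 : ln 2 < ln 3) by (apply ln_increasing; lra).
  assert (Hka : 0 < ka) by (unfold ka; nra).
  exists (/ 2 * Rpower (/ ka) alpha); split.
  { apply Rmult_lt_0_compat; [lra|apply exp_pos]. }
  destruct (INR_unbounded (exp ka)) as [n0 Hn0].
  exists n0; intros n Hn.
  assert (HnR : exp ka < INR n) by (eapply Rlt_le_trans; [exact Hn0|apply le_INR, Hn]).
  assert (Hn1 : (1 <= n)%nat).
  { destruct n; [|lia]; assert (P := exp_pos ka); simpl in HnR; lra. }
  assert (Hl : ka <= ln (INR n)).
  { rewrite <- (ln_exp ka); left; apply ln_increasing; [apply exp_pos|exact HnR]. }
  set (l := ln (INR n)) in *.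
  set (s := ka / l).
  assert (Hs : 0 < s) by (apply Rdiv_lt_0_compat; lra).
  assert (Hs1 : s <= 1).
  { unfold s; apply (Rmult_le_reg_r l); [lra|]; unfold Rdiv; rewrite Rmult_assoc, Rinv_l; lra. }
  assert (Hdp : forall k, 0 <= d (S k)) by (intros k; assert (H := d_ge_1 (S k) ltac:(lia)); lra).
  assert (Hser := d_series (1 + s) ltac:(lra)).
  assert (Hser2 := d_series (1 + s / 2) ltac:(lra)).
  assert (Htail : Series (fun k => d (S (n + k)) * npow (S (n + k)) (1 + s))
                  <= exp (- (ka / 2)) * Rpower (zetaR (1 + s / 2)) alpha).
  { rewrite <- (is_series_unique _ _ Hser2).
    assert (Hex : ex_series (fun k => d (S (n + k)) * npow (S (n + k)) (1 + s / 2))).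
    { apply (ex_series_incr_n (fun k => d (S k) * npow (S k) (1 + s / 2)) n).
      eexists; exact Hser2. }
    apply Rle_trans with
      (exp (- (ka / 2)) * Series (fun k => d (S (n + k)) * npow (S (n + k)) (1 + s / 2))).
    - rewrite <- Series_scal_l; apply Series_le;
        [|apply (ex_series_scal (exp (- (ka / 2)))
                   (fun k => d (S (n + k)) * npow (S (n + k)) (1 + s / 2))), Hex].
      intros k; split; [apply Rmult_le_pos; [apply Hdp|left; apply npow_pos]|].
      replace (1 + s) with ((1 + s / 2) + s / 2) by field.
      rewrite npow_plus.
      assert (Hk : npow (S (n + k)) (s / 2) <= exp (- (ka / 2))).
      { unfold npow; apply exp_le_compat.
        assert (Hll : l <= ln (INR (S (n + k)))).
        { apply ln_le; [apply lt_0_INR; lia|apply le_INR; lia]. }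
        assert (s / 2 * l <= s / 2 * ln (INR (S (n + k)))) by (apply Rmult_le_compat_l; lra).
        replace (s / 2 * l) with (ka / 2) in H by (unfold s; field; lra). lra. }
      assert (P1 := npow_pos (S (n + k)) (1 + s / 2)); assert (P2 := Hdp (n + k)%nat).
      assert (0 <= d (S (n + k)) * npow (S (n + k)) (1 + s / 2)) by nra.
      nra.
    - apply Rmult_le_compat_l; [left; apply exp_pos|].
      rewrite (Series_incr_n (fun k => d (S k) * npow (S k) (1 + s / 2)) n);
        [|lia|eexists; exact Hser2].
      rewrite <- sum_n_Reals.
      assert (0 <= sum_n (fun k => d (S k) * npow (S k) (1 + s / 2)) (pred n)).
      { apply sum_n_nonneg; intros; apply Rmult_le_pos; [apply Hdp|left; apply npow_pos]. }
      lra. }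
  assert (Hsplit := is_series_unique _ _ Hser).
  rewrite (Series_incr_n _ n) in Hsplit; [|lia|eexists; exact Hser].
  rewrite <- sum_n_Reals in Hsplit; replace (pred n) with (n - 1)%nat in Hsplit by lia.
  assert (Hhead : sum_n (fun k => d (S k) * npow (S k) (1 + s)) (n - 1)
                  <= sum_n (fun k => d (S k) / INR (S k)) (n - 1)).
  { apply sum_n_le_loc; intros k _.
    rewrite npow_plus, npow_one by lia.
    apply Rmult_le_compat_l; [apply Hdp|].
    assert (H := npow_le_1 (S k) s ltac:(lia) ltac:(lra)).
    assert (0 < / INR (S k)) by (apply Rinv_0_lt_compat, INR_S_pos); nra. }
  assert (Hz1 : Rpower (/ ka) alpha * Rpower l alpha <= Rpower (zetaR (1 + s)) alpha).
  { rewrite Rpower_mult_distr by (try apply Rinv_0_lt_compat; lra).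
    apply Rpower_le_compat_l; [lra|apply Rmult_lt_0_compat; [apply Rinv_0_lt_compat|]; lra|].
    replace (/ ka * l) with (/ s) by (unfold s; field; lra).
    apply zetaR_ge, Hs. }
  assert (Hz2 : Rpower (zetaR (1 + s / 2)) alpha
                <= Rpower 3 alpha * (Rpower (/ ka) alpha * Rpower l alpha)).
  { rewrite Rpower_mult_distr by (try apply Rinv_0_lt_compat; lra).
    replace (/ ka * l) with (/ s) by (unfold s; field; lra).
    assert (His : 1 <= / s) by (rewrite <- Rinv_1; apply Rinv_le_contravar; lra).
    rewrite Rpower_mult_distr by lra.
    assert (Hz := zetaR_ge_1 (1 + s / 2) ltac:(lra)).
    apply Rpower_le_compat_l; [lra|lra|].
    eapply Rle_trans; [apply zetaR_le; lra|].
    replace (/ (s / 2)) with (2 * / s) by (field; lra); lra. }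
  assert (He : exp (- (ka / 2)) * Rpower 3 alpha = / 2).
  { unfold Rpower; rewrite <- exp_plus.
    replace (- (ka / 2) + alpha * ln 3) with (- ln 2) by (unfold ka; field).
    rewrite exp_Ropp, exp_ln by lra; reflexivity. }
  set (X := Rpower (/ ka) alpha * Rpower l alpha) in *.
  assert (exp (- (ka / 2)) * Rpower (zetaR (1 + s / 2)) alpha <= / 2 * X).
  { rewrite <- He, Rmult_assoc; apply Rmult_le_compat_l; [left; apply exp_pos|exact Hz2]. }
  replace (/ 2 * Rpower (/ ka) alpha * Rpower l alpha) with (/ 2 * X) by (unfold X; ring).
  lra.
Qed.

End Growth.


(** * Complex series and sequences *)

Lemma Cmod_sq (z : C) : Cmod z ^ 2 = Re z ^ 2 + Im z ^ 2.
Proof.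
  unfold Cmod; rewrite pow2_sqrt; [reflexivity|].
  apply Rplus_le_le_0_compat; apply pow2_ge_0.
Qed.

Lemma Rabs_Re_le_Cmod (z : C) : Rabs (Re z) <= Cmod z.
Proof. eapply Rle_trans; [apply Rmax_l|apply Rmax_Cmod]. Qed.

Lemma Rabs_Im_le_Cmod (z : C) : Rabs (Im z) <= Cmod z.
Proof. eapply Rle_trans; [apply Rmax_r|apply Rmax_Cmod]. Qed.

Lemma ex_series_C_parts (u : nat -> C) : ex_series (fun k => Cmod (u k)) ->
  ex_series (fun k => Re (u k)) /\ ex_series (fun k => Im (u k)).
Proof.
  intros H; split; apply ex_series_Rabs; revert H; apply ex_series_le_R;
    intros k; split; try apply Rabs_pos; [apply Rabs_Re_le_Cmod|apply Rabs_Im_le_Cmod].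
Qed.

Lemma is_series_CSeries (u : nat -> C) : ex_series (fun k => Cmod (u k)) ->
  is_series u (CSeries u).
Proof.
  intros H; destruct (ex_series_C_parts u H); apply is_series_C_iff; split;
    apply Series_correct; assumption.
Qed.

Lemma Cmod_sum_n (u : nat -> C) (n : nat) : Cmod (sum_n u n) <= sum_n (fun k => Cmod (u k)) n.
Proof. exact (norm_sum_n_m u 0 n). Qed.

Lemma Cmod_CSeries (u : nat -> C) : ex_series (fun k => Cmod (u k)) ->
  Cmod (CSeries u) <= Series (fun k => Cmod (u k)).
Proof.
  intros H.
  assert (Hl : is_lim_seq (fun n => Cmod (sum_n u n)) (Cmod (CSeries u))).
  { apply (filterlim_comp _ _ _ (sum_n u) Cmod eventually
      (locally (CSeries u : C_NormedModule)) (locally (Cmod (CSeries u)))).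
    - exact (is_series_CSeries u H).
    - exact (@filterlim_norm C_AbsRing C_NormedModule (CSeries u)). }
  apply (is_lim_seq_le (fun n => Cmod (sum_n u n)) (fun _ => Series (fun k => Cmod (u k)))
    (Cmod (CSeries u)) (Series (fun k => Cmod (u k)))); [|exact Hl|apply is_lim_seq_const].
  intros n; eapply Rle_trans; [apply Cmod_sum_n|].
  apply sum_n_le_Series; [intros; apply Cmod_ge_0|exact H].
Qed.

Lemma CSeries_minus (u v : nat -> C) :
  ex_series (fun k => Cmod (u k)) -> ex_series (fun k => Cmod (v k)) ->
  CSeries (fun k => u k - v k)%C = (CSeries u - CSeries v)%C.
Proof.
  intros Hu Hv; destruct (ex_series_C_parts u Hu), (ex_series_C_parts v Hv).
  unfold CSeries at 1; rewrite (Series_ext _ (fun k => Re (u k) - Re (v k))) by reflexivity.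
  rewrite (Series_ext (fun k => Im (u k - v k)%C) (fun k => Im (u k) - Im (v k))) by reflexivity.
  rewrite !Series_minus by assumption; reflexivity.
Qed.

Lemma Cmod_minus_sq_le (a b : C) : Cmod (a - b)%C ^ 2 <= 2 * Cmod a ^ 2 + 2 * Cmod b ^ 2.
Proof.
  rewrite !Cmod_sq; destruct a as [a1 a2], b as [b1 b2]; simpl.
  assert (0 <= (a1 + b1) ^ 2 + (a2 + b2) ^ 2)
    by (apply Rplus_le_le_0_compat; apply pow2_ge_0).
  nra.
Qed.

Lemma is_lim_seq_sum_n (u : nat -> nat -> R) (l : nat -> R) (n : nat) :
  (forall k, is_lim_seq (u k) (l k)) ->
  is_lim_seq (fun m => sum_n (fun k => u k m) n) (sum_n l n).
Proof.
  intros H; induction n as [|n IH].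
  - apply (is_lim_seq_ext (u 0%nat)); [intros; symmetry; exact (sum_n_OR (fun k => u k n))|].
    rewrite sum_n_OR; apply H.
  - apply (is_lim_seq_ext (fun m => sum_n (fun k => u k m) n + u (S n) m));
      [intros m; symmetry; exact (sum_n_SR (fun k => u k m) n)|].
    rewrite sum_n_SR; apply is_lim_seq_plus'; [exact IH|apply H].
Qed.

Lemma is_lim_seq_sq (u : nat -> R) (l : R) : is_lim_seq u l ->
  is_lim_seq (fun n => u n ^ 2) (l ^ 2).
Proof.
  intros H; apply (is_lim_seq_ext (fun n => u n * u n)); [intros; ring|].
  replace (l ^ 2) with (l * l) by ring; apply is_lim_seq_mult'; exact H.
Qed.

(** * Diagonal extraction *)

(** [Bolzano_Weierstrass] yields a cluster point l; the subsequence repeatedly picks an index beyond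
    the previous one whose value is within 1/(n+1) of l. *)
Lemma Bolzano_Weierstrass_subseq (w : nat -> R) (b : R) : (forall n, Rabs (w n) <= b) ->
  exists psi : nat -> nat, (forall n, (psi n < psi (S n))%nat) /\
    exists l : R, is_lim_seq (fun n => w (psi n)) l.
Proof.
  intros Hw.
  destruct (Bolzano_Weierstrass w (fun c => - b <= c <= b)) as [l Hl].
  { apply compact_P3. }
  { intros n; apply Rabs_le_between, Hw. }
  assert (Hp : forall N n : nat, exists p, (N <= p)%nat /\ Rabs (w p - l) < / INR (S n)).
  { intros N n; apply (Hl (fun y => Rabs (y - l) < / INR (S n)) N).
    exists (mkposreal _ (Rinv_0_lt_compat _ (INR_S_pos n))); intros y Hy; exact Hy. }
  set (pick N n := proj1_sig (constructive_indefinite_description _ (Hp N n))).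
  assert (Hpick : forall N n, (N <= pick N n)%nat /\ Rabs (w (pick N n) - l) < / INR (S n))
    by (intros N n; exact (proj2_sig (constructive_indefinite_description _ (Hp N n)))).
  set (psi := fix psi n := match n with O => pick 0%nat 0%nat | S m => pick (S (psi m)) (S m) end).
  assert (Hpsi : forall n, Rabs (w (psi n) - l) < / INR (S n))
    by (intros [|n]; apply Hpick).
  exists psi; split; [intros n; exact (proj1 (Hpick (S (psi n)) (S n)))|exists l].
  apply is_lim_seq_spec; intros eps.
  destruct (INR_unbounded (/ eps)) as [N HN].
  exists N; intros n Hn; eapply Rlt_le_trans; [apply Hpsi|].
  rewrite <- (Rinv_inv eps); apply Rinv_le_contravar.
  - apply Rinv_0_lt_compat, cond_pos.
  - left; eapply Rlt_le_trans; [exact HN|apply le_INR; lia].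
Qed.

Lemma strictly_increasing_ge (psi : nat -> nat) :
  (forall n, (psi n < psi (S n))%nat) -> forall n, (n <= psi n)%nat.
Proof. intros H n; induction n as [|n IH]; [lia|specialize (H n); lia]. Qed.

Lemma diagonal_extraction (u : nat -> nat -> R) (b : R) :
  (forall j k, Rabs (u j k) <= b) ->
  exists phi : nat -> nat, (forall j, (phi j < phi (S j))%nat) /\
    forall k, exists l : R, is_lim_seq (fun j => u (phi j) k) l.
Proof.
  intros Hu.
  assert (H := fun (k : nat) (e : nat -> nat) =>
    Bolzano_Weierstrass_subseq (fun j => u (e j) k) b (fun j => Hu (e j) k)).
  set (psi k e := proj1_sig (constructive_indefinite_description _ (H k e))).
  assert (Hpsi : forall k e, (forall n, (psi k e n < psi k e (S n))%nat) /\
            exists l : R, is_lim_seq (fun n => u (e (psi k e n)) k) l)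
    by (intros k e; exact (proj2_sig (constructive_indefinite_description _ (H k e)))).
  (* [E (S k)] is a subsequence of [E k] along which column k converges. *)
  set (E := fix E k : nat -> nat := match k with
              | O => fun n => n | S k => fun n => E k (psi k (E k) n) end).
  assert (Einc : forall k m n, (m < n)%nat -> (E k m < E k n)%nat).
  { induction k as [|k IH]; intros m n Hmn; simpl; [exact Hmn|].
    apply IH; induction Hmn as [|n _ IH']; [apply Hpsi|].
    eapply Nat.lt_trans; [exact IH'|apply Hpsi]. }
  assert (Esub : forall t k n, exists h, (n <= h)%nat /\ E (t + k)%nat n = E k h).
  { induction t as [|t IH]; intros k n; simpl; [exists n; split; [lia|reflexivity]|].
    destruct (IH k (psi (t + k)%nat (E (t + k)%nat) n)) as [h [Hh Eh]].
    exists h; split; [|exact Eh].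
    assert (Hg := strictly_increasing_ge _ (proj1 (Hpsi (t + k)%nat (E (t + k)%nat))) n); lia. }
  (* The level S j handles columns 0..j, so from j = k on the diagonal runs inside [E (S k)], at
     positions at least j by [Esub]. *)
  exists (fun j => E (S j) j); split.
  - intros j; change (E (S (S j)) (S j)) with (E (S j) (psi (S j) (E (S j)) (S j))).
    apply Einc.
    assert (Hg := strictly_increasing_ge _ (proj1 (Hpsi (S j) (E (S j)))) (S j)); lia.
  - intros k; destruct (proj2 (Hpsi k (E k))) as [l Hl]; exists l.
    apply is_lim_seq_spec in Hl; apply is_lim_seq_spec; intros eps.
    destruct (Hl eps) as [N HN]; exists (max N k); intros j Hj.
    destruct (Esub (j - k)%nat (S k) j) as [h [Hh Eh]].
    replace (j - k + S k)%nat with (S j) in Eh by lia.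
    rewrite Eh; apply (HN h); lia.
Qed.

(** Real and imaginary parts are interleaved as even and odd columns, so a single real extraction
    serves both. *)
Lemma diagonal_extraction_C (x : nat -> nat -> C) (b : R) :
  (forall j k, Cmod (x j k) <= b) ->
  exists (phi : nat -> nat) (y : nat -> C), (forall j, (phi j < phi (S j))%nat) /\
    forall k, is_lim_seq (fun j => Re (x (phi j) k)) (Re (y k)) /\
              is_lim_seq (fun j => Im (x (phi j) k)) (Im (y k)).
Proof.
  intros Hx.
  destruct (diagonal_extraction
    (fun j k => if Nat.even k then Re (x j (Nat.div2 k)) else Im (x j (Nat.div2 k))) b)
    as [phi [Hphi Hl]].
  { intros j k; destruct (Nat.even k); eapply Rle_trans; try apply Hx;
      [apply Rabs_Re_le_Cmod|apply Rabs_Im_le_Cmod]. }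
  set (l k := proj1_sig (constructive_indefinite_description _ (Hl k))).
  assert (Hlim := fun k => proj2_sig (constructive_indefinite_description _ (Hl k))).
  cbv beta in Hlim.
  exists phi, (fun k => (l (2 * k)%nat, l (S (2 * k)))); split; [exact Hphi|].
  intros k; split; simpl Re; simpl Im.
  - generalize (Hlim (2 * k)%nat); fold (l (2 * k)%nat).
    rewrite Nat.even_even, Nat.div2_double; exact (fun h => h).
  - generalize (Hlim (S (2 * k))); fold (l (S (2 * k))).
    rewrite Nat.even_succ, Nat.div2_succ_double, <- Nat.negb_even, Nat.even_even.
    exact (fun h => h).
Qed.

(** * Operators dominated by a Schur-bounded kernel *)

Section Dominated.

Variables (K : nat -> nat -> R) (D : R).
Hypothesis K_nonneg : forall i j, 0 <= K i j.
Hypothesis K_bound : forall (u : nat -> R) (n m : nat),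
  sum_n (fun i => sum_n (fun j => K i j * u j) m ^ 2) n <= D ^ 2 * sum_n (fun j => u j ^ 2) m.

Lemma kernel_row_ex_series (v : nat -> R) (i : nat) :
  (forall j, 0 <= v j) -> ex_series (fun j => v j ^ 2) -> ex_series (fun j => K i j * v j).
Proof.
  intros Hv Hs; apply (ex_series_bounded _ (1 + D ^ 2 * Series (fun j => v j ^ 2))).
  - intros j; apply Rmult_le_pos; auto.
  - intros m; set (t := sum_n (fun j => K i j * v j) m).
    assert (H : t ^ 2 <= D ^ 2 * Series (fun j => v j ^ 2)).
    { eapply Rle_trans; [|eapply Rle_trans; [apply (K_bound v i m)|]].
      - apply (sum_n_term_le (fun i => sum_n (fun j => K i j * v j) m ^ 2) i i);
          [intros; apply pow2_ge_0|lia].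
      - apply Rmult_le_compat_l; [apply pow2_ge_0|].
        apply sum_n_le_Series; [intros; apply pow2_ge_0|exact Hs]. }
    (* This yields t <= 1 + t^2, turning the bound on the square into one on t. *)
    assert (0 <= (t - / 2) ^ 2) by apply pow2_ge_0; nra.
Qed.

(** The finite bound with the rows fixed and the number of columns tending to infinity. *)
Lemma kernel_l2_bound (v : nat -> R) (n : nat) :
  (forall j, 0 <= v j) -> ex_series (fun j => v j ^ 2) ->
  sum_n (fun i => Series (fun j => K i j * v j) ^ 2) n <= D ^ 2 * Series (fun j => v j ^ 2).
Proof.
  intros Hv Hs.
  apply (is_lim_seq_le (fun m => sum_n (fun i => sum_n (fun j => K i j * v j) m ^ 2) n)
    (fun _ => D ^ 2 * Series (fun j => v j ^ 2))
    (sum_n (fun i => Series (fun j => K i j * v j) ^ 2) n) (D ^ 2 * Series (fun j => v j ^ 2))).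
  - intros m; eapply Rle_trans; [apply K_bound|].
    apply Rmult_le_compat_l; [apply pow2_ge_0|].
    apply sum_n_le_Series; [intros; apply pow2_ge_0|exact Hs].
  - apply (is_lim_seq_sum_n (fun i m => sum_n (fun j => K i j * v j) m ^ 2)); intros i.
    apply (is_lim_seq_sq (sum_n (fun j => K i j * v j))).
    exact (Series_correct _ (kernel_row_ex_series v i Hv Hs)).
  - apply is_lim_seq_const.
Qed.

(** The counterpart of [matrix_op] indexed from 0; matrices indexed from N are shifted before they
    are passed in. *)
Definition apply_op (B : nat -> nat -> C) (z : nat -> C) (i : nat) : C :=
  CSeries (fun j => B i j * z j)%C.

Section Action.

Variables (B : nat -> nat -> C) (z : nat -> C) (v : nat -> R).
Hypothesis v_nonneg : forall j, 0 <= v j.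
Hypothesis v_l2 : ex_series (fun j => v j ^ 2).
Hypothesis dominated : forall i j, Cmod (B i j) * Cmod (z j) <= K i j * v j.

Lemma op_row_abs (i : nat) : ex_series (fun j => Cmod (B i j * z j)%C).
Proof.
  apply (ex_series_le_R _ (fun j => K i j * v j)).
  - intros j; split; [apply Cmod_ge_0|rewrite Cmod_mult; apply dominated].
  - apply kernel_row_ex_series; assumption.
Qed.

Lemma op_l2_partial (n : nat) :
  sum_n (fun i => Cmod (apply_op B z i) ^ 2) n <= D ^ 2 * Series (fun j => v j ^ 2).
Proof.
  eapply Rle_trans; [|apply (kernel_l2_bound v n v_nonneg v_l2)].
  apply sum_n_le_loc; intros i _; apply pow_incr; split; [apply Cmod_ge_0|].
  eapply Rle_trans; [apply Cmod_CSeries, op_row_abs|].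
  apply Series_le; [|apply kernel_row_ex_series; assumption].
  intros j; split; [apply Cmod_ge_0|rewrite Cmod_mult; apply dominated].
Qed.

Lemma op_l2 : ex_series (fun i => Cmod (apply_op B z i) ^ 2).
Proof.
  apply (ex_series_bounded _ (D ^ 2 * Series (fun j => v j ^ 2)));
    [intros; apply pow2_ge_0|apply op_l2_partial].
Qed.

(** The majorant [v] is independent of [z], which permits different constants on different columns,
    as [op_split_bound] requires. *)
Lemma op_l2_norm :
  Series (fun i => Cmod (apply_op B z i) ^ 2) <= D ^ 2 * Series (fun j => v j ^ 2).
Proof. apply Series_le_bound; [apply op_l2|apply op_l2_partial]. Qed.

End Action.

Section Compact.

Variables (B : nat -> nat -> C) (c : R).
Hypothesis c_nonneg : 0 <= c.
Hypothesis B_le : forall i j, Cmod (B i j) <= c * K i j.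
Hypothesis B_small : forall eps, 0 < eps ->
  exists Q : nat, forall i j, (Q <= j)%nat -> Cmod (B i j) <= eps * K i j.

Lemma scaled_l2 (z : nat -> C) : ex_series (fun j => Cmod (z j) ^ 2) ->
  ex_series (fun j => (c * Cmod (z j)) ^ 2).
Proof.
  intros Hz; apply (ex_series_ext (fun j => c ^ 2 * Cmod (z j) ^ 2)); [intros; symmetry; apply Rpow_mult_distr|].
  exact (ex_series_scal (c ^ 2) _ Hz).
Qed.

Lemma scaled_dominated (z : nat -> C) (i j : nat) :
  Cmod (B i j) * Cmod (z j) <= K i j * (c * Cmod (z j)).
Proof.
  assert (H := B_le i j); assert (P := Cmod_ge_0 (z j)).
  replace (K i j * (c * Cmod (z j))) with (c * K i j * Cmod (z j)) by ring.
  apply Rmult_le_compat_r; assumption.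
Qed.

Lemma scaled_nonneg (z : nat -> C) (j : nat) : 0 <= c * Cmod (z j).
Proof. apply Rmult_le_pos; [exact c_nonneg|apply Cmod_ge_0]. Qed.

Lemma dominated_op_row (z : nat -> C) (i : nat) : ex_series (fun j => Cmod (z j) ^ 2) ->
  ex_series (fun j => Cmod (B i j * z j)%C).
Proof.
  intros Hz; apply (op_row_abs B z (fun j => c * Cmod (z j)));
    [apply scaled_nonneg|apply scaled_l2, Hz|apply scaled_dominated].
Qed.

Lemma dominated_op_l2 (z : nat -> C) : ex_series (fun j => Cmod (z j) ^ 2) ->
  ex_series (fun i => Cmod (apply_op B z i) ^ 2).
Proof.
  intros Hz; apply (op_l2 B z (fun j => c * Cmod (z j)));
    [apply scaled_nonneg|apply scaled_l2, Hz|apply scaled_dominated].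
Qed.

(* Splits the columns of [B] at [Q]: the first ones are controlled by [c K],
   the others by [eps K]. *)
Lemma op_split_bound (z : nat -> C) (eps : R) (Q : nat) : 0 < eps ->
  (forall i j, (Q <= j)%nat -> Cmod (B i j) <= eps * K i j) ->
  ex_series (fun j => Cmod (z j) ^ 2) ->
  Series (fun i => Cmod (apply_op B z i) ^ 2)
  <= D ^ 2 * (2 * c ^ 2 * sum_n (fun j => Cmod (z j) ^ 2) Q
              + 2 * eps ^ 2 * Series (fun j => Cmod (z j) ^ 2)).
Proof.
  intros He HQ Hz.
  (* [r j + eps] dominates both regimes at once, and (r + eps)^2 <= 2 r^2 + 2 eps^2 separates the
     finitely supported part from the rest. *)
  set (r j := if Nat.leb j Q then c else 0).
  assert (Hr : forall j, 0 <= r j) by (intros j; unfold r; destruct (Nat.leb j Q); lra).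
  set (v j := (r j + eps) * Cmod (z j)).
  set (h j := r j ^ 2 * Cmod (z j) ^ 2).
  assert (Hh : is_series h (sum_n h Q)).
  { apply is_series_finite; intros k Hk; unfold h, r.
    destruct (Nat.leb_spec k Q); [lia|ring]. }
  assert (Hhs : sum_n h Q = c ^ 2 * sum_n (fun j => Cmod (z j) ^ 2) Q :> R).
  { rewrite <- sum_n_scalR; apply sum_n_ext_locR; intros k Hk; unfold h, r.
    destruct (Nat.leb_spec k Q); [reflexivity|lia]. }
  set (w j := 2 * h j + 2 * eps ^ 2 * Cmod (z j) ^ 2).
  assert (Hw : is_series w (2 * sum_n h Q + 2 * eps ^ 2 * Series (fun j => Cmod (z j) ^ 2))).
  { apply (is_series_plus (fun j => 2 * h j) (fun j => 2 * eps ^ 2 * Cmod (z j) ^ 2)).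
    - exact (is_series_scal 2 h _ Hh).
    - exact (is_series_scal (2 * eps ^ 2) _ _ (Series_correct _ Hz)). }
  assert (Hvw : forall j, 0 <= v j ^ 2 <= w j).
  { intros j; split; [apply pow2_ge_0|].
    assert (0 <= (r j - eps) ^ 2 * Cmod (z j) ^ 2)
      by (apply Rmult_le_pos; apply pow2_ge_0).
    unfold v, w, h; nra. }
  assert (Hvs : ex_series (fun j => v j ^ 2))
    by (apply (ex_series_le_R _ w Hvw); eexists; exact Hw).
  eapply Rle_trans; [apply (op_l2_norm B z v)|].
  - intros j; apply Rmult_le_pos; [specialize (Hr j); lra|apply Cmod_ge_0].
  - exact Hvs.
  - intros i j; unfold v; rewrite <- Rmult_assoc.
    apply Rmult_le_compat_r; [apply Cmod_ge_0|].
    assert (HK := K_nonneg i j); assert (H1 := B_le i j).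
    unfold r; destruct (Nat.leb_spec j Q).
    + nra.
    + specialize (HQ i j ltac:(lia)); lra.
  - apply Rmult_le_compat_l; [apply pow2_ge_0|].
    eapply Rle_trans; [apply (Series_le _ w Hvw); eexists; exact Hw|].
    rewrite (is_series_unique _ _ Hw), Hhs; right; ring.
Qed.

(** A subsequence converges coordinatewise, and its limit is in l2 with the same bound because
    partial sums pass to the limit. On the differences, the first columns of B are controlled by
    coordinatewise convergence and the others by smallness, so the images converge in norm to the
    image of the limit. *)
Lemma compact_of_small_columns (x : nat -> nat -> C) (M : R) :
  (forall j, ex_series (fun k => Cmod (x j k) ^ 2)) ->
  (forall j, Series (fun k => Cmod (x j k) ^ 2) <= M) ->
  exists (phi : nat -> nat) (y : nat -> C),
    (forall j, (phi j < phi (S j))%nat) /\ ex_series (fun i => Cmod (y i) ^ 2) /\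
    is_lim_seq (fun j => Series (fun i => Cmod (apply_op B (x (phi j)) i - y i)%C ^ 2)) 0.
Proof.
  intros Hx HM.
  assert (HM0 : 0 <= M).
  { eapply Rle_trans; [|apply (HM 0%nat)]. eapply Rle_trans; [|apply (sum_n_le_Series _ 0);
      [intros; apply pow2_ge_0|apply Hx]]. rewrite sum_n_OR; apply pow2_ge_0. }
  destruct (diagonal_extraction_C x (1 + M)) as (phi & y & Hphi & Hy).
  { intros j k.
    assert (H : Cmod (x j k) ^ 2 <= M).
    { eapply Rle_trans; [|apply (HM j)].
      eapply Rle_trans; [|apply (sum_n_le_Series _ k); [intros; apply pow2_ge_0|apply Hx]].
      apply (sum_n_term_le (fun k => Cmod (x j k) ^ 2)); [intros; apply pow2_ge_0|lia]. }
    assert (0 <= (Cmod (x j k) - / 2) ^ 2) by apply pow2_ge_0; nra. }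
  assert (Hysum : forall n, sum_n (fun k => Cmod (y k) ^ 2) n <= M).
  { intros n.
    apply (is_lim_seq_le (fun j => sum_n (fun k => Cmod (x (phi j) k) ^ 2) n) (fun _ => M)
      (sum_n (fun k => Cmod (y k) ^ 2) n) M).
    - intros j; eapply Rle_trans; [|apply (HM (phi j))].
      apply sum_n_le_Series; [intros; apply pow2_ge_0|apply Hx].
    - apply (is_lim_seq_sum_n (fun k j => Cmod (x (phi j) k) ^ 2)); intros k.
      apply (is_lim_seq_ext (fun j => Re (x (phi j) k) ^ 2 + Im (x (phi j) k) ^ 2));
        [intros; symmetry; apply Cmod_sq|].
      rewrite Cmod_sq; apply is_lim_seq_plus'; apply is_lim_seq_sq, Hy.
    - apply is_lim_seq_const. }
  assert (Hyl : ex_series (fun k => Cmod (y k) ^ 2))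
    by (apply (ex_series_bounded _ M); [intros; apply pow2_ge_0|exact Hysum]).
  set (z j k := (x (phi j) k - y k)%C).
  assert (Hzw : forall j k, 0 <= Cmod (z j k) ^ 2
                  <= 2 * Cmod (x (phi j) k) ^ 2 + 2 * Cmod (y k) ^ 2)
    by (intros j k; split; [apply pow2_ge_0|apply Cmod_minus_sq_le]).
  assert (Hw : forall j, is_series (fun k => 2 * Cmod (x (phi j) k) ^ 2 + 2 * Cmod (y k) ^ 2)
     (2 * Series (fun k => Cmod (x (phi j) k) ^ 2) + 2 * Series (fun k => Cmod (y k) ^ 2))).
  { intros j; apply (is_series_plus (fun k => 2 * Cmod (x (phi j) k) ^ 2)
      (fun k => 2 * Cmod (y k) ^ 2)).
    - exact (is_series_scal 2 _ _ (Series_correct _ (Hx (phi j)))).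
    - exact (is_series_scal 2 _ _ (Series_correct _ Hyl)). }
  assert (Hz : forall j, ex_series (fun k => Cmod (z j k) ^ 2))
    by (intros j; apply (ex_series_le_R _ _ (Hzw j)); eexists; apply Hw).
  assert (HzM : forall j, Series (fun k => Cmod (z j k) ^ 2) <= 4 * M).
  { intros j; eapply Rle_trans; [apply (Series_le _ _ (Hzw j)); eexists; apply Hw|].
    rewrite (is_series_unique _ _ (Hw j)).
    assert (H1 := HM (phi j)); assert (H2 := Series_le_bound _ M Hyl Hysum); lra. }
  exists phi, (apply_op B y); split; [exact Hphi|split; [apply dominated_op_l2, Hyl|]].
  apply (is_lim_seq_ext (fun j => Series (fun i => Cmod (apply_op B (z j) i) ^ 2))).
  { intros j; apply Series_ext; intros i; unfold apply_op; do 2 f_equal.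
    rewrite <- CSeries_minus by (apply dominated_op_row; [apply Hx || apply Hyl]).
    f_equal; unfold z.
    apply functional_extensionality; intros k; ring. }
  apply is_lim_seq_spec; intros eps.
  (* With e^2 = eps / (2 P), the far columns contribute at most D^2 (2 e^2)(4 M) <= eps/2, where 4 M
     bounds the squared norm of the differences; the 1 keeps P positive when D or M is 0. *)
  set (P := 8 * D ^ 2 * M + 1).
  assert (HP : 0 < P) by (unfold P; assert (0 <= D ^ 2 * M)
    by (apply Rmult_le_pos; [apply pow2_ge_0|exact HM0]); lra).
  assert (Hep := cond_pos eps).
  set (e := sqrt (eps / 2 / P)).
  assert (He0 : 0 < eps / 2 / P) by (apply Rdiv_lt_0_compat; lra).
  assert (He : 0 < e) by (apply sqrt_lt_R0, He0).
  assert (He2 : e ^ 2 = eps / 2 / P) by (apply pow2_sqrt; lra).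
  destruct (B_small e He) as [Q HQ].
  assert (Hlim : is_lim_seq (fun j => D ^ 2 * (2 * c ^ 2) * sum_n (fun k => Cmod (z j k) ^ 2) Q)
     (D ^ 2 * (2 * c ^ 2) * 0)).
  { apply (is_lim_seq_scal_l _ _ (Finite 0)).
    rewrite <- (sum_n_zero (fun _ => 0) Q) by reflexivity.
    apply (is_lim_seq_sum_n (fun k j => Cmod (z j k) ^ 2) (fun _ => 0)); intros k.
    apply (is_lim_seq_ext (fun j => (Re (x (phi j) k) - Re (y k)) ^ 2
      + (Im (x (phi j) k) - Im (y k)) ^ 2)); [intros; symmetry; apply Cmod_sq|].
    replace 0 with ((Re (y k) - Re (y k)) ^ 2 + (Im (y k) - Im (y k)) ^ 2) by ring.
    apply is_lim_seq_plus'; apply is_lim_seq_sq, is_lim_seq_minus';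
      try apply is_lim_seq_const; apply Hy. }
  rewrite Rmult_0_r in Hlim; apply is_lim_seq_spec in Hlim.
  destruct (Hlim (mkposreal (eps / 2) ltac:(lra))) as [J HJ].
  exists J; intros j Hj; specialize (HJ j Hj); simpl pos in HJ.
  rewrite Rminus_0_r in HJ; rewrite Rminus_0_r.
  assert (HS := op_split_bound (z j) e Q He HQ (Hz j)).
  rewrite Rabs_pos_eq.
  2:{ eapply Rle_trans; [|apply (sum_n_le_Series _ 0); [intros; apply pow2_ge_0|]].
      - rewrite sum_n_OR; apply pow2_ge_0.
      - apply dominated_op_l2, Hz. }
  eapply Rle_lt_trans; [exact HS|].
  assert (H1 := Rle_lt_trans _ _ _ (Rle_abs _) HJ).
  assert (H2 : D ^ 2 * (2 * e ^ 2 * Series (fun k => Cmod (z j k) ^ 2)) <= eps / 2).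
  { apply Rle_trans with (D ^ 2 * (2 * e ^ 2 * (4 * M))).
    - apply Rmult_le_compat_l; [apply pow2_ge_0|].
      apply Rmult_le_compat_l; [assert (0 <= e ^ 2) by apply pow2_ge_0; lra|apply HzM].
    - rewrite He2.
      replace (D ^ 2 * (2 * (eps / 2 / P) * (4 * M))) with (eps / 2 * ((P - 1) / P))
        by (replace (P - 1) with (8 * D ^ 2 * M) by (unfold P; ring); field; lra).
      rewrite <- (Rmult_1_r (eps / 2)) at 2; apply Rmult_le_compat_l; [lra|].
      apply (Rmult_le_reg_r P); [exact HP|]; unfold Rdiv; rewrite Rmult_assoc, Rinv_l; lra. }
  lra.
Qed.

End Compact.

End Dominated.


(** * Hankel forms *)

(** The Schur domination has to hold at every index, whereas the O-hypothesis holds only eventually;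
    the finitely many exceptions are absorbed into the constant one by one. *)
Lemma eventually_bound_everywhere (f g : nat -> R) (c : R) (n0 : nat) :
  (forall n, (1 <= n)%nat -> 0 < g n) ->
  (forall n, (1 <= n)%nat -> (n0 <= n)%nat -> f n <= c * g n) ->
  exists c', 0 <= c' /\ forall n, (1 <= n)%nat -> f n <= c' * g n.
Proof.
  intros Hg; revert c; induction n0 as [|n0 IH]; intros c H.
  - exists (Rmax 0 c); split; [apply Rmax_l|]; intros n Hn.
    eapply Rle_trans; [apply H; lia|].
    apply Rmult_le_compat_r; [left; apply Hg, Hn|apply Rmax_r].
  - apply (IH (Rmax c (f n0 / g n0))); intros n Hn Hn0.
    assert (P := Hg n Hn).
    destruct (Nat.eq_dec n n0) as [->|Hne].
    + apply Rle_trans with (f n0 / g n0 * g n0); [right; field; lra|].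
      apply Rmult_le_compat_r; [lra|apply Rmax_r].
    + eapply Rle_trans; [apply H; lia|].
      apply Rmult_le_compat_r; [lra|apply Rmax_l].
Qed.

Lemma Re_RtoC (r : R) : Re (RtoC r) = r.
Proof. reflexivity. Qed.

Lemma Re_div_RtoC (z : C) (r : R) : r <> 0 -> Re (z / RtoC r)%C = Re z / r.
Proof. intros Hr; destruct z as [a b]; simpl; field; exact Hr. Qed.

Lemma sum_n_shift_le (g : nat -> R) (s n : nat) : (forall k, 0 <= g k) ->
  sum_n (fun j => g (s + j)%nat) n <= sum_n g (s + n).
Proof.
  intros Hg; induction n as [|n IH].
  - rewrite sum_n_OR, Nat.add_0_r; apply sum_n_term_le; [intros; apply Hg|lia].
  - rewrite Nat.add_succ_r, !sum_n_SR, Nat.add_succ_r; lra.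
Qed.

Lemma sum_n_shift_split (g : nat -> R) (s n : nat) :
  sum_n (fun j => g (S s + j)%nat) n + sum_n g s = sum_n g (S s + n) :> R.
Proof.
  induction n as [|n IH].
  - rewrite sum_n_OR, !Nat.add_0_r, sum_n_SR; apply Rplus_comm.
  - rewrite Nat.add_succ_r, !sum_n_SR, Nat.add_succ_r, <- IH; ring.
Qed.

Definition seg (f : nat -> R) (X Y n : nat) : R :=
  if andb (Nat.leb X n) (Nat.leb n Y) then f n else 0.

Lemma seg_in (f : nat -> R) (X Y n : nat) : (X <= n <= Y)%nat -> seg f X Y n = f n.
Proof.
  intros H; unfold seg.
  destruct (Nat.leb_spec X n), (Nat.leb_spec n Y); simpl; try lia; reflexivity.
Qed.

Lemma seg_out (f : nat -> R) (X Y n : nat) : (n < X \/ Y < n)%nat -> seg f X Y n = 0.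
Proof.
  intros H; unfold seg.
  destruct (Nat.leb_spec X n), (Nat.leb_spec n Y); simpl; try lia; reflexivity.
Qed.

Lemma seg_sum (f : nat -> R) (N x k : nat) :
  sum_n (fun i => seg f (N + x) (N + x + k) (N + i)) (x + k)
  = sum_n (fun i => f (N + x + i)%nat) k :> R.
Proof.
  assert (H : forall m, (m <= k)%nat ->
    sum_n (fun i => seg f (N + x) (N + x + k) (N + i)) (x + m)
    = sum_n (fun i => f (N + x + i)%nat) m :> R).
  { induction m as [|m IH]; intros Hm.
    - rewrite Nat.add_0_r, (sum_n_single _ x x), sum_n_OR, seg_in; [|lia|lia|].
      + f_equal; lia.
      + intros i Hi Hne; apply seg_out; lia.
    - rewrite Nat.add_succ_r, !sum_n_SR, IH by lia.
      rewrite seg_in by lia; do 2 f_equal; lia. }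
  apply H; lia.
Qed.

Section Hankel.

Variables (alpha : R) (d : nat -> R).
Hypothesis alpha_gt_1 : 1 < alpha.
Hypothesis d_series : forall x, 1 < x ->
  is_series (fun k => d (S k) * npow (S k) x) (Rpower (zetaR x) alpha).

Let d_ge_1 : forall n, (1 <= n)%nat -> 1 <= d n := zeta_pow_coeff_ge_1 alpha d alpha_gt_1 d_series.

Definition pw (n : nat) : R := Rpower (lnmax2 n) (- (alpha / 2)).
(** The quotient of [rho0] by [d] for n >= 2, with a positive value at n = 1. *)
Definition tau (n : nat) : R := / sqrt (INR n) * Rpower (lnmax2 n) (- alpha).

Lemma d_pos (n : nat) : (1 <= n)%nat -> 0 < d n.
Proof. intros Hn; assert (H := d_ge_1 n Hn); lra. Qed.

Lemma INR_pos (n : nat) : (1 <= n)%nat -> 0 < INR n.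
Proof. intros; apply lt_0_INR; lia. Qed.

Lemma tau_pos (n : nat) : (1 <= n)%nat -> 0 < tau n.
Proof.
  intros Hn; apply Rmult_lt_0_compat; [|apply exp_pos].
  apply Rinv_0_lt_compat, sqrt_lt_R0, INR_pos, Hn.
Qed.

Lemma pw_sq (n : nat) : pw n ^ 2 = Rpower (lnmax2 n) (- alpha).
Proof.
  unfold pw; replace (- alpha) with (- (alpha / 2) + - (alpha / 2)) by field.
  rewrite Rpower_plus; ring.
Qed.

Lemma pw_antitone (m n : nat) : (m <= n)%nat -> pw n <= pw m.
Proof.
  intros H; unfold pw, Rpower; apply exp_le_compat.
  assert (P := ln2_pos); assert (Hm := lnmax2_ge m).
  assert (Hl : ln (lnmax2 m) <= ln (lnmax2 n)).
  { apply ln_le; [lra|]; apply ln_le; [apply lt_0_INR; lia|apply le_INR; lia]. }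
  nra.
Qed.

Lemma rho0_tau (n : nat) : (2 <= n)%nat -> rho0 alpha d n = d n * tau n.
Proof.
  intros Hn; unfold rho0, tau, lnmax2; rewrite Nat.max_l, Rpower_Ropp by lia.
  unfold Rdiv; rewrite Rinv_mult; reflexivity.
Qed.

Lemma rho0_pos (n : nat) : (2 <= n)%nat -> 0 < rho0 alpha d n.
Proof.
  intros Hn; rewrite rho0_tau by exact Hn.
  apply Rmult_lt_0_compat; [apply d_pos|apply tau_pos]; lia.
Qed.

(** ln (m n) is at least the larger of ln m and ln n; keeping only that one turns the Hankel kernel
    into the model kernel. *)
Lemma tau_mul_le (m n : nat) : (1 <= m)%nat -> (1 <= n)%nat ->
  tau (m * n) <= / sqrt (INR m) * / sqrt (INR n) * Rmin (pw m) (pw n) ^ 2.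
Proof.
  intros Hm Hn; unfold tau.
  assert (Pm := INR_pos m Hm); assert (Pn := INR_pos n Hn).
  rewrite mult_INR, sqrt_mult, Rinv_mult, <- pw_sq by lra.
  apply Rmult_le_compat_l.
  - apply Rmult_le_pos; left; apply Rinv_0_lt_compat, sqrt_lt_R0; assumption.
  - apply pow_incr; split; [left; apply exp_pos|].
    apply Rmin_glb; apply pw_antitone; nia.
Qed.

Lemma bigO_tau (rho : nat -> C) : seq_bigO rho (rho0 alpha d) ->
  exists c, 0 <= c /\ forall n, (1 <= n)%nat -> Cmod (rho n) <= c * (d n * tau n).
Proof.
  intros [K [n0 H]].
  apply (eventually_bound_everywhere _ (fun n => d n * tau n) K (n0 + 2)).
  - intros n Hn; apply Rmult_lt_0_compat; [apply d_pos|apply tau_pos]; exact Hn.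
  - intros n Hn Hn0; specialize (H n ltac:(lia)).
    rewrite Rabs_pos_eq, rho0_tau in H by (try lia; left; apply rho0_pos; lia); exact H.
Qed.

Definition qq (N i : nat) : R := sqrt (d (N + i)%nat / INR (N + i)).
Definition pp (N i : nat) : R := pw (N + i).
Definition hker (N : nat) : nat -> nat -> R := model_kernel (qq N) (pp N).

Lemma e_pos (n : nat) : (1 <= n)%nat -> 0 < d n / INR n.
Proof. intros Hn; apply Rdiv_lt_0_compat; [apply d_pos|apply INR_pos]; exact Hn. Qed.

Lemma qq_pos (N i : nat) : (1 <= N)%nat -> 0 < qq N i.
Proof. intros HN; apply sqrt_lt_R0, e_pos; lia. Qed.

Lemma hker_nonneg (N : nat) : (1 <= N)%nat -> forall i j, 0 <= hker N i j.
Proof. intros HN i j; apply model_kernel_nonneg; intros; apply qq_pos, HN. Qed.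

(** The growth hypothesis of the model kernel is [coeff_sum_upper]: the square of [pw] cancels the
    power of the logarithm. *)
Lemma hker_bound (N : nat) : (1 <= N)%nat -> exists D, 0 <= D /\
  forall (u : nat -> R) (n m : nat),
  sum_n (fun i => sum_n (fun j => hker N i j * u j) m ^ 2) n
    <= D ^ 2 * sum_n (fun j => u j ^ 2) m.
Proof.
  intros HN.
  set (C0 := exp 1 * Rpower (1 + / ln 2) alpha).
  assert (HC0 : 0 <= C0) by (left; apply Rmult_lt_0_compat; apply exp_pos).
  exists (5 * C0); split; [lra|].
  apply model_kernel_bound.
  - intros; apply qq_pos, HN.
  - intros; apply exp_pos.
  - intros; apply pw_antitone; lia.
  - intros n; unfold pp; rewrite pw_sq.
    assert (H : sum_n (fun j => qq N j ^ 2) n <= C0 * Rpower (lnmax2 (N + n)) alpha).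
    { eapply Rle_trans; [|apply (coeff_sum_upper alpha d alpha_gt_1 d_series (N + n)); lia].
      replace (N + n - 1)%nat with ((N - 1) + n)%nat by lia.
      eapply Rle_trans; [|apply sum_n_shift_le; intros; left; apply e_pos; lia].
      right; apply sum_n_extR; intros j; unfold qq.
      rewrite pow2_sqrt by (left; apply e_pos; lia).
      replace (S (N - 1 + j)) with (N + j)%nat by lia; reflexivity. }
    apply Rle_trans with (C0 * Rpower (lnmax2 (N + n)) alpha * Rpower (lnmax2 (N + n)) (- alpha)).
    + apply Rmult_le_compat_r; [left; apply exp_pos|exact H].
    + assert (P := ln2_pos); assert (Hl := lnmax2_ge (N + n)).
      rewrite Rmult_assoc, <- Rpower_plus, Rplus_opp_r, Rpower_O by lra; lra.
Qed.

Lemma hker_entry (N i j : nat) : (1 <= N)%nat ->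
  sqrt (d (N + i)%nat) * sqrt (d (N + j)%nat) * tau ((N + i) * (N + j)) <= hker N i j.
Proof.
  intros HN.
  assert (Pi := INR_pos (N + i) ltac:(lia)); assert (Pj := INR_pos (N + j) ltac:(lia)).
  assert (Di := d_pos (N + i) ltac:(lia)); assert (Dj := d_pos (N + j) ltac:(lia)).
  unfold hker, model_kernel, qq, pp; rewrite !sqrt_div_alt by assumption.
  apply Rle_trans with (sqrt (d (N + i)%nat) * sqrt (d (N + j)%nat)
    * (/ sqrt (INR (N + i)) * / sqrt (INR (N + j)) * Rmin (pw (N + i)) (pw (N + j)) ^ 2)).
  - apply Rmult_le_compat_l; [apply Rmult_le_pos; apply sqrt_pos|apply tau_mul_le; lia].
  - right; unfold Rdiv; ring.
Qed.

Lemma hankel_matrix_le (rho : nat -> C) (c : R) (N i j : nat) : (1 <= N)%nat -> 0 <= c ->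
  (Cmod (rho ((N + i) * (N + j))%nat)
    <= c * (d ((N + i) * (N + j))%nat * tau ((N + i) * (N + j)))) ->
  Cmod (hankel_matrix d rho (N + i) (N + j)) <= c * hker N i j.
Proof.
  intros HN Hc H.
  set (m := (N + i)%nat) in *; set (n := (N + j)%nat) in *.
  assert (Dm := d_pos m ltac:(lia)); assert (Dn := d_pos n ltac:(lia)).
  assert (Dmn := d_pos (m * n) ltac:(nia)).
  unfold hankel_matrix; rewrite Cmod_mult, Cmod_R, sqrt_mult by lra.
  assert (Hp : 0 <= sqrt (d m) * sqrt (d n)) by (apply Rmult_le_pos; apply sqrt_pos).
  rewrite Rabs_pos_eq by (apply Rdiv_le_0_compat; assumption).
  apply Rle_trans with (sqrt (d m) * sqrt (d n) / d (m * n)%nat * (c * (d (m * n)%nat * tau (m * n)))).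
  - apply Rmult_le_compat_l; [apply Rdiv_le_0_compat; assumption|exact H].
  - replace (sqrt (d m) * sqrt (d n) / d (m * n)%nat * (c * (d (m * n)%nat * tau (m * n))))
      with (c * (sqrt (d m) * sqrt (d n) * tau (m * n))) by (field; lra).
    apply Rmult_le_compat_l; [exact Hc|apply hker_entry, HN].
Qed.

Lemma hankel_form_shift (rho : nat -> C) (N k : nat) (a b : nat -> C) :
  hankel_form d rho N (N + k) a b =
  sum_n (fun i => sum_n (fun j => a (N + i)%nat * b (N + j)%nat *
    (rho ((N + i) * (N + j))%nat / RtoC (d ((N + i) * (N + j))%nat)))%C k) k.
Proof.
  unfold hankel_form; rewrite sum_n_m_shift; apply sum_n_ext; intros i.
  apply (sum_n_m_shift (fun n => a (N + i)%nat * b n * (rho ((N + i) * n)%nat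
    / RtoC (d ((N + i) * n)%nat)))%C).
Qed.

Lemma l2w_norm_finite (N k : nat) (a : nat -> C) : supported_upto (N + k) a ->
  l2w_norm d N a = sqrt (sum_n (fun i => Cmod (a (N + i)%nat) ^ 2 / d (N + i)%nat) k).
Proof.
  intros Ha; unfold l2w_norm; f_equal; apply is_series_unique, is_series_finite.
  intros i Hi; rewrite Ha, Cmod_0 by lia; unfold Rdiv; ring.
Qed.

(** Dividing by sqrt d turns the weighted norms into plain l2 norms of u and v. The form is then at
    most c times the pairing of u with the kernel applied to v, and Cauchy-Schwarz with [hker_bound]
    concludes. *)
Theorem bigO_hankel_bounded (rho : nat -> C) (N : nat) : (1 <= N)%nat ->
  seq_bigO rho (rho0 alpha d) -> hankel_bounded d rho N.
Proof.
  intros HN Hrho.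
  destruct (bigO_tau rho Hrho) as [c [Hc Hct]].
  destruct (hker_bound N HN) as [D [HD HDb]].
  exists (c * D); intros M a b Ha Hb.
  (* For M < N the form is an empty sum. *)
  destruct (Nat.le_gt_cases N M) as [HM|HM].
  2:{ unfold hankel_form; rewrite sum_n_m_zero by exact HM.
      change (Cmod (RtoC 0) <= c * D * l2w_norm d N a * l2w_norm d N b).
      rewrite Cmod_0; repeat apply Rmult_le_pos; try assumption; apply sqrt_pos. }
  replace M with (N + (M - N))%nat in * by lia; set (k := (M - N)%nat) in *.
  rewrite hankel_form_shift, (l2w_norm_finite N k a Ha), (l2w_norm_finite N k b Hb).
  set (u i := Cmod (a (N + i)%nat) / sqrt (d (N + i)%nat)).
  set (v i := Cmod (b (N + i)%nat) / sqrt (d (N + i)%nat)).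
  assert (Hdp : forall i, 0 < d (N + i)%nat) by (intros; apply d_pos; lia).
  assert (Hsd : forall i, 0 < sqrt (d (N + i)%nat)) by (intros; apply sqrt_lt_R0, Hdp).
  assert (Hsq : forall (f : nat -> C) i, (Cmod (f (N + i)%nat) / sqrt (d (N + i)%nat)) ^ 2
      = Cmod (f (N + i)%nat) ^ 2 / d (N + i)%nat).
  { intros f i; unfold Rdiv; rewrite Rpow_mult_distr, pow_inv, pow2_sqrt
      by (left; apply Hdp); reflexivity. }
  rewrite (sum_n_extR _ (fun i => u i ^ 2)) by (intros; symmetry; apply Hsq).
  rewrite (sum_n_extR (fun i => Cmod (b (N + i)%nat) ^ 2 / d (N + i)%nat) (fun i => v i ^ 2))
    by (intros; symmetry; apply Hsq).
  set (U := sum_n (fun i => u i ^ 2) k); set (V := sum_n (fun i => v i ^ 2) k).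
  set (W i := sum_n (fun j => hker N i j * v j) k).
  apply Rle_trans with (c * sum_n (fun i => u i * W i) k).
  { eapply Rle_trans; [apply Cmod_sum_n|].
    rewrite <- sum_n_scalR; apply sum_n_le_loc; intros i _.
    eapply Rle_trans; [apply Cmod_sum_n|].
    unfold W; rewrite <- !sum_n_scalR; apply sum_n_le_loc; intros j _.
    assert (Dmn := d_pos ((N + i) * (N + j)) ltac:(nia)).
    rewrite !Cmod_mult, Cmod_div by (intros E; apply RtoC_inj in E; lra).
    rewrite Cmod_R, (Rabs_pos_eq (d _)) by lra.
    apply Rle_trans with (Cmod (a (N + i)%nat) * Cmod (b (N + j)%nat)
      * (c * tau ((N + i) * (N + j)))).
    - apply Rmult_le_compat_l; [apply Rmult_le_pos; apply Cmod_ge_0|].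
      apply (Rmult_le_reg_r (d ((N + i) * (N + j))%nat)); [exact Dmn|].
      unfold Rdiv; rewrite Rmult_assoc, Rinv_l, Rmult_1_r by lra.
      eapply Rle_trans; [apply Hct; nia|right; ring].
    - apply Rle_trans with (c * (u i * (sqrt (d (N + i)%nat) * sqrt (d (N + j)%nat)
        * tau ((N + i) * (N + j)) * v j))).
      + right; unfold u, v; field; split; apply Rgt_not_eq, Hsd.
      + apply Rmult_le_compat_l; [exact Hc|].
        apply Rmult_le_compat_l; [apply Rdiv_le_0_compat; [apply Cmod_ge_0|apply Hsd]|].
        apply Rmult_le_compat_r; [apply Rdiv_le_0_compat; [apply Cmod_ge_0|apply Hsd]|].
        apply hker_entry, HN. }
  assert (HU : 0 <= U) by (apply sum_n_nonneg; intros; apply pow2_ge_0).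
  assert (HV : 0 <= V) by (apply sum_n_nonneg; intros; apply pow2_ge_0).
  assert (HCS := Cauchy_Schwarz_sum_n u W k); fold U in HCS.
  assert (HW := HDb v k k); fold V in HW; change (sum_n (fun i => W i ^ 2) k <= D ^ 2 * V) in HW.
  rewrite !Rmult_assoc; apply Rmult_le_compat_l; [exact Hc|].
  apply Rsqr_incr_0_var; [|apply Rmult_le_pos; [exact HD|apply Rmult_le_pos; apply sqrt_pos]].
  rewrite !Rsqr_mult, !Rsqr_sqrt, !Rsqr_pow2 by assumption.
  eapply Rle_trans; [exact HCS|].
  apply Rle_trans with (U * (D ^ 2 * V)); [apply Rmult_le_compat_l; assumption|right; ring].
Qed.

Lemma littleo_bigO (rho : nat -> C) :
  seq_littleo rho (rho0 alpha d) -> seq_bigO rho (rho0 alpha d).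
Proof. intros H; exists 1; apply H; lra. Qed.

Theorem littleo_hankel_compact (rho : nat -> C) :
  seq_littleo rho (rho0 alpha d) -> hankel_compact d rho 1.
Proof.
  intros Hrho.
  destruct (bigO_tau rho (littleo_bigO rho Hrho)) as [c [Hc Hct]].
  destruct (hker_bound 1 (le_n 1)) as [D [HD HDb]].
  set (B i j := hankel_matrix d rho (1 + i) (1 + j)).
  assert (HB : forall i j, Cmod (B i j) <= c * hker 1 i j).
  { intros i j; apply hankel_matrix_le; [lia|exact Hc|apply Hct; lia]. }
  (* The product (1+i)(1+j) is at least 1 + j, so a large column index alone places every entry of
     the column in the small range. *)
  assert (HBs : forall eps, 0 < eps -> exists Q : nat, forall i j, (Q <= j)%nat ->
     Cmod (B i j) <= eps * hker 1 i j).
  { intros eps He; destruct (Hrho eps He) as [n0 H]; exists (n0 + 2)%nat; intros i j Hj.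
    apply hankel_matrix_le; [lia|lra|].
    specialize (H ((1 + i) * (1 + j))%nat ltac:(nia)).
    rewrite Rabs_pos_eq, rho0_tau in H by (try nia; left; apply rho0_pos; nia); exact H. }
  assert (HK := hker_nonneg 1 (le_n 1)).
  split.
  - intros a Ha; split.
    + intros [|i] Hm; [lia|].
      eexists; apply (is_series_CSeries (fun j => B i j * a (1 + j)%nat)%C).
      apply (dominated_op_row (hker 1) D HK HDb B c Hc HB (fun j => a (1 + j)%nat) i Ha).
    + exact (dominated_op_l2 (hker 1) D HK HDb B c Hc HB (fun j => a (1 + j)%nat) Ha).
  - intros x K Hx.
    destruct (compact_of_small_columns (hker 1) D HK HDb B c Hc HB HBs
      (fun j k => x j (1 + k)%nat) (K ^ 2)) as (phi & y & Hphi & Hy & Hlim).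
    + intros j; apply Hx.
    + intros j; destruct (Hx j) as [H1 H2]; unfold l2_norm in H2.
      set (S0 := Series (fun k => Cmod (x j (1 + k)%nat) ^ 2)) in *.
      assert (HS0 : 0 <= S0).
      { eapply Rle_trans; [|apply (sum_n_le_Series _ 0); [intros; apply pow2_ge_0|exact H1]].
        rewrite sum_n_OR; apply pow2_ge_0. }
      rewrite <- (pow2_sqrt S0 HS0); apply pow_incr; split; [apply sqrt_pos|exact H2].
    (* The value at 0 lies outside the index set. *)
    + exists phi, (fun n => match n with O => RtoC 0 | S k => y k end).
      split; [exact Hphi|split; [exact Hy|]].
      rewrite <- sqrt_0.
      exact (is_lim_seq_continuous sqrt _ 0 (continuity_pt_sqrt 0 (Rle_refl 0)) Hlim).
Qed.

(** * Lower bounds from test sequences on segments *)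

(** The mass below X is a fixed number, so for Y far enough out it is at most half of c (ln
    Y)^alpha, and the segment [X, Y] carries the other half. *)
Lemma test_mass : exists c1 : R, 0 < c1 /\ forall X, (2 <= X)%nat -> exists k : nat,
  c1 * Rpower (ln (INR (X + k))) alpha <= sum_n (fun i => d (X + i)%nat / INR (X + i)) k.
Proof.
  destruct (coeff_sum_lower alpha d alpha_gt_1 d_series) as (c & Hc & n0 & Hlow).
  exists (c / 2); split; [lra|]; intros X HX.
  set (g k := d (S k) / INR (S k)).
  assert (Hg : forall k, 0 <= g k) by (intros; left; apply e_pos; lia).
  set (S0 := sum_n g (X - 2)).
  (* ln Y >= 1 gives ln Y <= (ln Y)^alpha, and ln Y >= 2 S0 / c then makes [S0] at most half of the
     lower bound. *)
  destruct (INR_unbounded (exp (Rmax 1 (2 * S0 / c)))) as [n1 Hn1].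
  exists (n0 + n1)%nat; set (Y := (X + (n0 + n1))%nat).
  specialize (Hlow Y ltac:(lia)); fold g in Hlow.
  assert (E := sum_n_shift_split g (X - 2) (n0 + n1)); fold S0 in E.
  replace (S (X - 2) + (n0 + n1))%nat with (Y - 1)%nat in E by lia.
  rewrite (sum_n_extR _ (fun i => d (X + i)%nat / INR (X + i))) in E.
  2:{ intros i; unfold g; replace (S (S (X - 2) + i)) with (X + i)%nat by lia; reflexivity. }
  assert (Hl : Rmax 1 (2 * S0 / c) <= ln (INR Y)).
  { rewrite <- (ln_exp (Rmax _ _)); apply ln_le; [apply exp_pos|].
    left; eapply Rlt_le_trans; [exact Hn1|apply le_INR; lia]. }
  assert (H1 := Rmax_l 1 (2 * S0 / c)); assert (H2 := Rmax_r 1 (2 * S0 / c)).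
  assert (Hp : ln (INR Y) <= Rpower (ln (INR Y)) alpha).
  { rewrite <- (Rpower_1 (ln (INR Y))) at 1 by lra; apply Rle_Rpower; lra. }
  assert (H3 : S0 <= c / 2 * Rpower (ln (INR Y)) alpha).
  { replace S0 with (c / 2 * (2 * S0 / c)) by (field; lra).
    apply Rmult_le_compat_l; lra. }
  change (sum_n (fun k => d (S k) / INR (S k)) (Y - 1)) with (sum_n g (Y - 1)) in Hlow.
  lra.
Qed.

(** On the segment ln (m n) <= 2 ln Y, so the kernel is bounded below by one of rank one. *)
Lemma tau_seg_ge (X Y m n : nat) : (2 <= X)%nat -> (X <= m <= Y)%nat -> (X <= n <= Y)%nat ->
  Rpower (2 * ln (INR Y)) (- alpha) <= sqrt (INR m) * sqrt (INR n) * tau (m * n).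
Proof.
  intros HX Hm Hn; unfold tau, lnmax2; rewrite Nat.max_l by nia.
  assert (Pm := INR_pos m ltac:(lia)); assert (Pn := INR_pos n ltac:(lia)).
  assert (Sm := sqrt_lt_R0 _ Pm); assert (Sn := sqrt_lt_R0 _ Pn).
  rewrite mult_INR, sqrt_mult, ln_mult by lra.
  replace (sqrt (INR m) * sqrt (INR n)
    * (/ (sqrt (INR m) * sqrt (INR n)) * Rpower (ln (INR m) + ln (INR n)) (- alpha)))
    with (Rpower (ln (INR m) + ln (INR n)) (- alpha)) by (field; lra).
  rewrite !Rpower_Ropp; apply Rinv_le_contravar; [apply exp_pos|].
  assert (P := ln2_pos).
  assert (H2 : forall k, (2 <= k)%nat -> ln 2 <= ln (INR k)).
  { intros k Hk; apply ln_le; [lra|]; replace 2 with (INR 2) by (simpl; ring).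
    apply le_INR, Hk. }
  assert (Lm := H2 m ltac:(lia)); assert (Ln := H2 n ltac:(lia)).
  assert (Um : ln (INR m) <= ln (INR Y)) by (apply ln_le; [lra|apply le_INR; lia]).
  assert (Un : ln (INR n) <= ln (INR Y)) by (apply ln_le; [lra|apply le_INR; lia]).
  apply Rpower_le_compat_l; lra.
Qed.

(** For the sequence d n / sqrt n on a segment of mass W, the squared norm is W and the form of
    [rho0] is at least (2 ln Y)^(-alpha) W^2. Their quotient thus has a lower bound that does not
    depend on the segment. *)
Lemma test_mass_energy (Y : nat) (c1 W : R) : (2 <= Y)%nat ->
  c1 * Rpower (ln (INR Y)) alpha <= W ->
  c1 * Rpower 2 (- alpha) <= Rpower (2 * ln (INR Y)) (- alpha) * W.
Proof.
  intros HY HW.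
  assert (HL : 0 < ln (INR Y)).
  { rewrite <- ln_1; apply ln_increasing; [lra|]; apply lt_1_INR; lia. }
  rewrite <- Rpower_mult_distr by lra.
  apply Rle_trans with (Rpower 2 (- alpha) * Rpower (ln (INR Y)) (- alpha)
    * (c1 * Rpower (ln (INR Y)) alpha)).
  - right.
    assert (E : Rpower (ln (INR Y)) (- alpha) * Rpower (ln (INR Y)) alpha = 1)
      by (rewrite <- Rpower_plus, Rplus_opp_l; apply Rpower_O, HL).
    transitivity (c1 * Rpower 2 (- alpha)
      * (Rpower (ln (INR Y)) (- alpha) * Rpower (ln (INR Y)) alpha)); [rewrite E; ring|ring].
  - apply Rmult_le_compat_l; [apply Rmult_le_pos; left; apply exp_pos|exact HW].
Qed.

Theorem ratio_infty_hankel_unbounded (rho : nat -> C) :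
  is_lim_seq (fun n => Re (rho n / RtoC (rho0 alpha d n))%C) p_infty ->
  ~ hankel_bounded d rho 1.
Proof.
  intros Hlim [K HK].
  destruct test_mass as (c1 & Hc1 & Hmass).
  set (c2 := c1 * Rpower 2 (- alpha)).
  assert (Hc2 : 0 < c2) by (apply Rmult_lt_0_compat; [exact Hc1|apply exp_pos]).
  (* Beyond n0 the real part of rho exceeds T [rho0], so on nonnegative test sequences the quotient
     of form and squared norm is at least T c2 = |K| + 1, more than K. *)
  set (T := (Rabs K + 1) / c2).
  assert (HT : 0 < T) by (apply Rdiv_lt_0_compat; [assert (P := Rabs_pos K); lra|exact Hc2]).
  apply is_lim_seq_spec in Hlim; destruct (Hlim T) as [n0 Hn0].
  set (x := S n0); set (X := (1 + x)%nat).
  destruct (Hmass X ltac:(lia)) as [k Hk].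
  set (Y := (X + k)%nat) in *.
  set (e n := d n / INR n).
  set (f n := d n / sqrt (INR n)).
  set (W := sum_n (fun i => e (X + i)%nat) k) in *.
  set (t0 := Rpower (2 * ln (INR Y)) (- alpha)).
  assert (Ht0 : 0 < t0) by apply exp_pos.
  assert (Hen : c2 <= t0 * W) by (apply test_mass_energy; [lia|exact Hk]).
  assert (HW : 0 < W) by nra.
  set (a n := RtoC (seg f X Y n)).
  assert (Ha : supported_upto (1 + (x + k)) a).
  { intros n Hn; unfold a; rewrite seg_out; [reflexivity|lia]. }
  assert (Hsum : sum_n (fun i => seg e X Y (1 + i)) (x + k) = W :> R) by apply seg_sum.
  assert (Hnorm : l2w_norm d 1 a = sqrt W).
  { rewrite (l2w_norm_finite 1 (x + k) a Ha), <- Hsum; f_equal; apply sum_n_extR; intros i.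
    unfold a; rewrite Cmod_R, pow2_abs; unfold seg; destruct (andb _ _); [|unfold Rdiv; ring].
    assert (Di := d_pos (1 + i) ltac:(lia)); assert (Pi := INR_pos (1 + i) ltac:(lia)).
    unfold f, e, Rdiv; rewrite Rpow_mult_distr, pow_inv, pow2_sqrt by lra; field; lra. }
  specialize (HK (1 + (x + k))%nat a a Ha Ha).
  rewrite Hnorm, Rmult_assoc, sqrt_sqrt in HK by lra.
  assert (HRe : T * t0 * W * W <= Re (hankel_form d rho 1 (1 + (x + k)) a a)).
  { rewrite hankel_form_shift, sum_n_Re.
    apply Rle_trans with (sum_n (fun i => seg e X Y (1 + i)
      * sum_n (fun j => T * t0 * seg e X Y (1 + j)) (x + k)) (x + k)).
    { right; rewrite sum_n_scalR_r, sum_n_scalR, Hsum; ring. }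
    apply sum_n_le_loc; intros i Hi; rewrite sum_n_Re, <- sum_n_scalR.
    apply sum_n_le_loc; intros j Hj.
    set (m := (1 + i)%nat); set (n := (1 + j)%nat).
    assert (Dmn := d_pos (m * n) ltac:(nia)).
    replace (Re (a m * a n * (rho (m * n)%nat / RtoC (d (m * n)%nat)))%C)
      with (seg f X Y m * seg f X Y n * (Re (rho (m * n)%nat) / d (m * n)%nat))
      by (rewrite <- Re_div_RtoC by lra; unfold a; simpl; ring).
    destruct (Nat.le_gt_cases X m) as [Hm|Hm]; [|rewrite !(seg_out _ X Y m) by lia; lra].
    destruct (Nat.le_gt_cases X n) as [Hn|Hn]; [|rewrite !(seg_out _ X Y n) by lia; lra].
    rewrite !seg_in by lia.
    assert (Hrho := Hn0 (m * n)%nat ltac:(nia)); cbv beta in Hrho.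
    assert (Hr0 := rho0_pos (m * n) ltac:(nia)).
    rewrite Re_div_RtoC in Hrho by lra.
    assert (HR : T * tau (m * n) <= Re (rho (m * n)%nat) / d (m * n)%nat).
    { apply (Rmult_le_reg_r (d (m * n)%nat)); [exact Dmn|].
      unfold Rdiv; rewrite (Rmult_assoc (Re _)), Rinv_l, Rmult_1_r by lra.
      apply (Rmult_lt_compat_r (rho0 alpha d (m * n))) in Hrho; [|exact Hr0].
      unfold Rdiv in Hrho; rewrite (Rmult_assoc (Re _)), Rinv_l, Rmult_1_r in Hrho by lra.
      rewrite rho0_tau in Hrho by nia; lra. }
    assert (Ht := tau_seg_ge X Y m n ltac:(lia) ltac:(lia) ltac:(lia)); fold t0 in Ht.
    assert (Dm := d_pos m ltac:(lia)); assert (Dn := d_pos n ltac:(lia)).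
    assert (Pm := INR_pos m ltac:(lia)); assert (Pn := INR_pos n ltac:(lia)).
    assert (Sm := sqrt_lt_R0 _ Pm); assert (Sn := sqrt_lt_R0 _ Pn).
    assert (Em : e m * sqrt (INR m) = f m).
    { unfold e, f; rewrite <- (sqrt_sqrt (INR m)) at 1 by lra; field; lra. }
    assert (En : e n * sqrt (INR n) = f n).
    { unfold e, f; rewrite <- (sqrt_sqrt (INR n)) at 1 by lra; field; lra. }
    assert (Pem : 0 < e m) by (apply e_pos; lia); assert (Pen : 0 < e n) by (apply e_pos; lia).
    apply Rle_trans with (f m * f n * (T * tau (m * n))).
    - rewrite <- Em, <- En.
      replace (e m * sqrt (INR m) * (e n * sqrt (INR n)) * (T * tau (m * n)))
        with (e m * (T * (sqrt (INR m) * sqrt (INR n) * tau (m * n)) * e n)) by ring.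
      apply Rmult_le_compat_l; [lra|]; apply Rmult_le_compat_r; [lra|].
      apply Rmult_le_compat_l; lra.
    - apply Rmult_le_compat_l; [|exact HR].
      rewrite <- Em, <- En; apply Rmult_le_pos; apply Rmult_le_pos; lra. }
  assert (H1 := Rle_trans _ _ _ (Rle_abs _) (Rabs_Re_le_Cmod
    (hankel_form d rho 1 (1 + (x + k)) a a))).
  assert (H2 : T * c2 = Rabs K + 1) by (unfold T; field; lra).
  assert (H3 := Rle_abs K).
  assert (H4 : T * c2 <= T * (t0 * W)) by (apply Rmult_le_compat_l; lra).
  assert (H5 : T * t0 * W * W <= K * W) by lra.
  apply Rmult_le_reg_r in H5; [lra|exact HW].
Qed.

(** * Failure of compactness for [rho0] *)

Lemma l2_tail_small (u : nat -> R) (del : R) : (forall k, 0 <= u k) -> ex_series u -> 0 < del ->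
  exists J : nat, forall j k, (J < j)%nat -> sum_n (fun i => u (j + i)%nat) k < del.
Proof.
  intros Hu Hs Hd.
  assert (Hl : is_lim_seq (sum_n u) (Series u)) by exact (Series_correct u Hs).
  apply is_lim_seq_spec in Hl; destruct (Hl (mkposreal del Hd)) as [J HJ].
  exists J; intros [|j] k Hj; [lia|].
  assert (E := sum_n_shift_split u j k).
  assert (H1 := sum_n_le_Series u (S j + k) Hu Hs).
  specialize (HJ j ltac:(lia)); simpl in HJ; apply Rabs_def2 in HJ; lra.
Qed.

Lemma hankel_matrix_rho0 (m n : nat) : (2 <= m)%nat -> (2 <= n)%nat ->
  hankel_matrix d (fun n => RtoC (rho0 alpha d n)) m n
  = RtoC (sqrt (d m) * sqrt (d n) * tau (m * n)).
Proof.
  intros Hm Hn.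
  assert (Dm := d_pos m ltac:(lia)); assert (Dn := d_pos n ltac:(lia)).
  assert (Dmn := d_pos (m * n) ltac:(nia)).
  unfold hankel_matrix; rewrite rho0_tau, sqrt_mult, <- RtoC_mult by (nia || lra).
  f_equal; field; lra.
Qed.

(** Unit vectors on segments starting at 2 + j have quadratic form at least c2. If the images of a
    subsequence converged to y, the pairing of such a vector with its image would split into a part
    bounded by the norm of the image minus y and a part bounded by the tail of y. Both tend to 0, a
    contradiction. *)
Theorem rho0_hankel_not_compact : ~ hankel_compact d (fun n => RtoC (rho0 alpha d n)) 2.
Proof.
  intros [Hop Hcomp].
  set (A := hankel_matrix d (fun n => RtoC (rho0 alpha d n))) in *.
  destruct test_mass as (c1 & Hc1 & Hmass).
  set (c2 := c1 * Rpower 2 (- alpha)).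
  assert (Hc2 : 0 < c2) by (apply Rmult_lt_0_compat; [exact Hc1|apply exp_pos]).
  set (kk j := proj1_sig (constructive_indefinite_description _
    (Hmass (2 + j)%nat ltac:(lia)))).
  assert (Hkk := fun j => proj2_sig (constructive_indefinite_description _
    (Hmass (2 + j)%nat ltac:(lia)))).
  change (forall j, c1 * Rpower (ln (INR (2 + j + kk j))) alpha
    <= sum_n (fun i => d (2 + j + i)%nat / INR (2 + j + i)) (kk j)) in Hkk.
  set (e n := d n / INR n).
  set (W j := sum_n (fun i => e (2 + j + i)%nat) (kk j)).
  set (t0 j := Rpower (2 * ln (INR (2 + j + kk j))) (- alpha)).
  assert (Hen : forall j, c2 <= t0 j * W j) by (intros j; apply test_mass_energy; [lia|apply Hkk]).
  assert (HW : forall j, 0 < W j)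
    by (intros j; specialize (Hen j); assert (0 < t0 j) by apply exp_pos; nra).
  (* The test sequence d n / sqrt n divided by sqrt (d n), which carries it into plain l2, and then
     normalized. *)
  set (xi j n := seg (fun n => sqrt (e n)) (2 + j) (2 + j + kk j) n / sqrt (W j)).
  assert (HsW : forall j, 0 < sqrt (W j)) by (intros; apply sqrt_lt_R0, HW).
  assert (Hxi0 : forall j i, (j + kk j < i)%nat -> xi j (2 + i)%nat = 0).
  { intros j i Hi; unfold xi; rewrite seg_out by lia; unfold Rdiv; ring. }
  assert (Hxi2 : forall j, sum_n (fun i => xi j (2 + i)%nat ^ 2) (j + kk j) = 1 :> R).
  { intros j.
    rewrite (sum_n_extR _ (fun i => seg e (2 + j) (2 + j + kk j) (2 + i) * / W j)).
    - rewrite sum_n_scalR_r, seg_sum; fold (W j); apply Rinv_r, Rgt_not_eq, HW.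
    - intros i; unfold xi, Rdiv; rewrite Rpow_mult_distr, pow_inv, pow2_sqrt by (left; apply HW).
      f_equal; unfold seg; destruct (andb _ _); [|ring].
      apply pow2_sqrt; left; apply e_pos; lia. }
  set (xs j n := RtoC (xi j n)).
  assert (Hxs : forall j, is_series (fun k => Cmod (xs j (2 + k)%nat) ^ 2) 1).
  { intros j; rewrite <- (Hxi2 j).
    apply (is_series_ext (fun k => xi j (2 + k)%nat ^ 2)).
    - intros k; unfold xs; rewrite Cmod_R; symmetry; apply pow2_abs.
    - apply is_series_finite; intros k Hk; rewrite Hxi0 by exact Hk; ring. }
  destruct (Hcomp xs 1) as (phi & y & Hphi & Hy & Hlim).
  { intros j; split; [eexists; apply Hxs|].
    unfold l2_norm; rewrite (is_series_unique _ _ (Hxs j)), sqrt_1; lra. }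
  set (inner j (z : nat -> C) := sum_n (fun i => Re (z (2 + i)%nat) * xi j (2 + i)%nat) (j + kk j)).
  assert (Hlow : forall j, c2 <= inner j (matrix_op A 2 (xs j))).
  { intros j; eapply Rle_trans; [apply (Hen j)|].
    set (X := (2 + j)%nat); set (Y := (2 + j + kk j)%nat).
    assert (Hentry : forall i, Re (matrix_op A 2 (xs j) (2 + i)%nat)
      = sum_n (fun l => Re (A (2 + i)%nat (2 + l)%nat) * xi j (2 + l)%nat) (j + kk j)).
    { intros i; unfold matrix_op, CSeries; simpl Re.
      rewrite (Series_ext _ (fun l => Re (A (2 + i)%nat (2 + l)%nat) * xi j (2 + l)%nat))
        by (intros l; unfold xs; simpl; ring).
      apply is_series_unique, is_series_finite; intros l Hl; rewrite Hxi0 by exact Hl; ring. }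
    unfold inner.
    apply Rle_trans with (sum_n (fun i => seg e X Y (2 + i)
      * sum_n (fun l => t0 j / W j * seg e X Y (2 + l)) (j + kk j)) (j + kk j)).
    { rewrite sum_n_scalR_r, sum_n_scalR; unfold X, Y; rewrite seg_sum; fold (W j).
      right; field; apply Rgt_not_eq, HW. }
    apply sum_n_le_loc; intros i Hi; rewrite Hentry, <- sum_n_scalR, <- sum_n_scalR_r.
    apply sum_n_le_loc; intros l Hl.
    unfold A; rewrite hankel_matrix_rho0, Re_RtoC by lia; unfold xi; fold X Y.
    set (m := (2 + i)%nat); set (n := (2 + l)%nat).
    destruct (Nat.le_gt_cases X m) as [Hm|Hm];
      [|rewrite !(seg_out _ X Y m) by lia; unfold Rdiv; lra].
    destruct (Nat.le_gt_cases X n) as [Hn|Hn];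
      [|rewrite !(seg_out _ X Y n) by lia; unfold Rdiv; lra].
    rewrite !seg_in by lia.
    assert (Ht := tau_seg_ge X Y m n ltac:(lia) ltac:(lia) ltac:(lia)); fold (t0 j) in Ht.
    assert (Dm := d_pos m ltac:(lia)); assert (Dn := d_pos n ltac:(lia)).
    assert (Pm := INR_pos m ltac:(lia)); assert (Pn := INR_pos n ltac:(lia)).
    assert (Sm := sqrt_lt_R0 _ Pm); assert (Sn := sqrt_lt_R0 _ Pn).
    assert (Pem : 0 < e m) by (apply e_pos; lia); assert (Pen : 0 < e n) by (apply e_pos; lia).
    assert (Hsq : forall n, (1 <= n)%nat -> sqrt (d n) * sqrt (e n) = e n * sqrt (INR n)).
    { intros r Hr; assert (Dr := d_pos r Hr); assert (Pr := INR_pos r Hr).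
      assert (Sr := sqrt_lt_R0 _ Pr).
      unfold e; rewrite sqrt_div_alt by exact Pr.
      rewrite <- (sqrt_sqrt (d r)) at 3 by lra.
      rewrite <- (sqrt_sqrt (INR r)) at 2 by lra; field; lra. }
    apply Rle_trans with (e m * e n * / W j
      * (sqrt (INR m) * sqrt (INR n) * tau (m * n))).
    - apply Rle_trans with (e m * e n * / W j * t0 j); [right; unfold Rdiv; ring|].
      apply Rmult_le_compat_l; [|exact Ht].
      apply Rmult_le_pos; [apply Rmult_le_pos; lra|left; apply Rinv_0_lt_compat, HW].
    - right.
      transitivity ((sqrt (d m) * sqrt (e m)) * (sqrt (d n) * sqrt (e n)) * tau (m * n) * / W j).
      + rewrite !Hsq by lia; ring.
      + rewrite <- (sqrt_sqrt (W j)) at 1 by (left; apply HW).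
        field; apply Rgt_not_eq, HsW. }
  assert (HTx : forall j, in_l2 2 (matrix_op A 2 (xs j)))
    by (intros j; apply Hop; eexists; apply Hxs).
  assert (Hdiff : forall j, ex_series (fun k =>
     Cmod (matrix_op A 2 (xs j) (2 + k)%nat - y (2 + k)%nat)%C ^ 2)).
  { intros j; apply (ex_series_le_R _ (fun k =>
      2 * Cmod (matrix_op A 2 (xs j) (2 + k)%nat) ^ 2 + 2 * Cmod (y (2 + k)%nat) ^ 2)).
    - intros k; split; [apply pow2_ge_0|apply Cmod_minus_sq_le].
    - apply (ex_series_plus (fun k => 2 * Cmod (matrix_op A 2 (xs j) (2 + k)%nat) ^ 2)
        (fun k => 2 * Cmod (y (2 + k)%nat) ^ 2)).
      + exact (ex_series_scal 2 _ (HTx j)).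
      + exact (ex_series_scal 2 _ Hy). }
  assert (Hre2 : forall z : C, Re z ^ 2 <= Cmod z ^ 2)
    by (intros z; rewrite Cmod_sq; assert (0 <= Im z ^ 2) by apply pow2_ge_0; lra).
  destruct (l2_tail_small (fun k => Cmod (y (2 + k)%nat) ^ 2) ((c2 / 2) ^ 2)) as [J HJ];
    [intros; apply pow2_ge_0|exact Hy|apply pow_lt; lra|].
  apply is_lim_seq_spec in Hlim.
  destruct (Hlim (mkposreal (c2 / 2) ltac:(lra))) as [J' HJ'].
  (* As phi j0 >= j0, this index is past both thresholds: J' for the convergence and J for the tail
     of y. *)
  set (j0 := S (J + J')); set (j := phi j0).
  specialize (HJ' j0 ltac:(lia)); fold j in HJ'; simpl pos in HJ'.
  assert (Hj : (J < j)%nat) 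
    by (assert (H := strictly_increasing_ge phi Hphi j0); unfold j, j0 in *; lia).
  rewrite Rminus_0_r in HJ'; apply Rabs_def2 in HJ'; destruct HJ' as [HJ' _].
  set (delta n := (matrix_op A 2 (xs j) n - y n)%C) in *.
  assert (Hdd : ex_series (fun k => Cmod (delta (2 + k)%nat) ^ 2)) by exact (Hdiff j).
  assert (Esplit : inner j (matrix_op A 2 (xs j)) = inner j delta + inner j y).
  { unfold inner; rewrite <- sum_n_plusR; apply sum_n_extR; intros i; unfold delta.
    rewrite <- Rmult_plus_distr_r; f_equal.
    change (Re (matrix_op A 2 (xs j) (2 + i)%nat)
      = Re (matrix_op A 2 (xs j) (2 + i)%nat) - Re (y (2 + i)%nat) + Re (y (2 + i)%nat)); ring. }
  assert (H1 : inner j delta <= l2_norm 2 delta).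
  { apply Rsqr_incr_0_var; [|apply sqrt_pos].
    unfold l2_norm; rewrite Rsqr_sqrt, Rsqr_pow2.
    2:{ eapply Rle_trans; [|apply (sum_n_le_Series _ 0); [intros; apply pow2_ge_0|exact Hdd]].
        rewrite sum_n_OR; apply pow2_ge_0. }
    eapply Rle_trans; [apply (Cauchy_Schwarz_sum_n (fun i => Re (delta (2 + i)%nat))
      (fun i => xi j (2 + i)%nat))|].
    rewrite Hxi2, Rmult_1_r.
    eapply Rle_trans; [|apply (sum_n_le_Series _ (j + kk j)); [intros; apply pow2_ge_0|exact Hdd]].
    apply sum_n_le_loc; intros; apply Hre2. }
  assert (H2 : inner j y <= c2 / 2).
  { apply Rsqr_incr_0_var; [|lra]; rewrite !Rsqr_pow2.
    unfold inner.
    rewrite (sum_n_extR _ (fun i => seg (fun n => Re (y n)) (2 + j) (2 + j + kk j) (2 + i)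
                                    * xi j (2 + i)%nat)).
    2:{ intros i; unfold xi, seg; destruct (andb _ _); [reflexivity|unfold Rdiv; ring]. }
    eapply Rle_trans; [apply (Cauchy_Schwarz_sum_n _ (fun i => xi j (2 + i)%nat))|]; rewrite Hxi2, Rmult_1_r.
    rewrite (sum_n_extR _ (fun i => seg (fun n => Re (y n) ^ 2) (2 + j) (2 + j + kk j) (2 + i)))
      by (intros i; unfold seg; destruct (andb _ _); ring).
    rewrite seg_sum; left; eapply Rle_lt_trans; [|apply (HJ j (kk j) Hj)].
    apply sum_n_le_loc; intros i _; apply Hre2. }
  specialize (Hlow j); rewrite Esplit in Hlow; lra.
Qed.

Lemma hankel_form_rho0 (M : nat) (a b : nat -> C) :
  hankel_form d (fun n => RtoC (rho0 alpha d n)) 2 M a b =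
  sum_n_m (fun m => sum_n_m (fun n =>
    a m * b n / RtoC (sqrt (INR (m * n)) * Rpower (ln (INR (m * n))) alpha))%C 2 M) 2 M.
Proof.
  unfold hankel_form; apply sum_n_m_ext_loc; intros m Hm; apply sum_n_m_ext_loc; intros n Hn.
  assert (Dmn := d_pos (m * n) ltac:(nia)).
  assert (Q : 0 < sqrt (INR (m * n)) * Rpower (ln (INR (m * n))) alpha).
  { apply Rmult_lt_0_compat; [apply sqrt_lt_R0, INR_pos; nia|apply exp_pos]. }
  unfold rho0; set (r := sqrt _ * _) in *.
  rewrite RtoC_div by lra.
  match goal with |- ?u = ?v => change (@eq C u v) end.
  field; split; intros E; apply RtoC_inj in E; lra.
Qed.

End Hankel.

Theorem mainTheorem4 (alpha : R) (d : nat -> R)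
    (halpha : 1 < alpha) (hd : zeta_pow_coeffs alpha d) :
  ((forall (M : nat) (a b : nat -> C),
      hankel_form d (fun n => RtoC (rho0 alpha d n)) 2 M a b =
      sum_n_m (fun m => sum_n_m (fun n =>
        a m * b n / RtoC (sqrt (INR (m * n)) * Rpower (ln (INR (m * n))) alpha))%C
        2 M) 2 M) /\
   hankel_bounded d (fun n => RtoC (rho0 alpha d n)) 2 /\
   ~ hankel_compact d (fun n => RtoC (rho0 alpha d n)) 2) /\
  (forall rho : nat -> C,
     (seq_bigO rho (rho0 alpha d) -> hankel_bounded d rho 1) /\
     (seq_littleo rho (rho0 alpha d) -> hankel_compact d rho 1) /\
     (is_lim_seq (fun n => Re (rho n / RtoC (rho0 alpha d n))%C) p_infty ->
        ~ hankel_bounded d rho 1)).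
Proof.
  assert (hs := zeta_pow_coeffs_real alpha d hd).
  split; [split; [|split]|intros rho; split; [|split]].
  - intros M a b; apply hankel_form_rho0; assumption.
  - apply (bigO_hankel_bounded alpha); try assumption; [lia|].
    exists 1, 0%nat; intros n _; rewrite Cmod_R; lra.
  - apply rho0_hankel_not_compact; assumption.
  - apply bigO_hankel_bounded; try assumption; lia.
  - apply littleo_hankel_compact; assumption.
  - apply ratio_infty_hankel_unbounded; assumption.
Qed.
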